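(* Let $v$ be a weight on $\mathbb{D}$ which satisfies condition $(B)$, and assume that there is some $\epsilon>0$ with $$\sup_{n=1,2,\ldots}\frac{\int_0^1 r^{n-n^{\epsilon}}v(r)\,dr}{\int_0^1 r^n v(r)\,dr}<\infty .$$ If the symbol $a$ is radial and (as a function of $r=|z|$) continuously differentiable on $[0,1]$, then $T_a:H_v^\infty\to H_v^\infty$ is bounded.
   Context: $\mathbb{D}$ is the open unit disc of $\mathbb{C}$. A weight $v$ on $\mathbb{D}$ is a continuous strictly positive function with $v(z)=v(|z|)$ for all $z\in\mathbb{D}$, $\lim_{|z|\to1}v(z)=0$ and $v(r)\ge v(s)$ if $0<r<s<1$. $H_v^\infty$ is the Banach space of holomorphic $h:\mathbb{D}\to\mathbb{C}$ with $\|h\|_v:=\sup_{z\in\mathbb{D}}|h(z)|v(|z|)<\infty$. A (complex valued) symbol $a$ is radial if $a(z)=a(|z|)$. Toeplitz operator: $T_ah=P_v(a\cdot h)$, where $P_v$ is the orthogonal projection of $L_v^2=L^2(\mathbb{D},v(r)\,r\,dr\,d\varphi)$ onto its subspace $A_v^2$ of holomorphic functions. For radial $a$ it is the Taylor coefficient multiplier: for $h(z)=\sum_{n\ge0}h_nz^n$, $$T_ah(z)=\sum_{n=0}^\infty\gamma_nh_nz^n,\qquad \gamma_n=\frac{\int_0^1r^{2n+1}v(r)a(r)\,dr}{\int_0^1r^{2n+1}v(r)\,dr}.$$ Condition $(B)$: for each (real) $m>0$ let $r_m$ be a point where $r\mapsto r^mv(r)$ attains its absolute maximum on $[0,1]$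 (with $v(1)=0$). The weight $v$ satisfies $(B)$ if $$\forall b_1>1\ \exists b_2>1\ \exists c>0\ \forall m,n>0:\quad \Big(\frac{r_m}{r_n}\Big)^m\frac{v(r_m)}{v(r_n)}\le b_1\ \text{ and }\ m,n,|m-n|\ge c\ \Rightarrow\ \Big(\frac{r_n}{r_m}\Big)^n\frac{v(r_n)}{v(r_m)}\le b_2 ,$$ where $m,n$ are real numbers, not necessarily integers. *)

(* Defs.v *)
From Stdlib Require Import Reals.
From Coquelicot Require Import Coquelicot.
Open Scope R_scope.

(* Functions on the open unit disc are total functions on [C] of which only
   the values on [disc] are ever used; [v (RtoC r)] is the radial profile. *)
Definition disc (z : C) : Prop := Cmod z < 1.

Definition is_weight (v : C -> R) : Prop :=
  (forall z, disc z -> continuous (v : C_UniformSpace -> R_UniformSpace) z) /\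
  (forall z, disc z -> 0 < v z) /\
  (forall z, disc z -> v z = v (RtoC (Cmod z))) /\
  (forall eps, 0 < eps -> exists delta, 0 < delta /\
     forall z, disc z -> 1 - delta < Cmod z -> Rabs (v z) < eps) /\
  (forall r s, 0 < r -> r < s -> s < 1 -> v (RtoC s) <= v (RtoC r)).

Definition holomorphic (h : C -> C) : Prop :=
  forall z, disc z -> @ex_derive C_AbsRing C_NormedModule h z.

Definition norm_v (v : C -> R) (h : C -> C) : Rbar :=
  Lub_Rbar (fun x => exists z, disc z /\ x = Cmod (h z) * v (RtoC (Cmod z))).

Definition H_v (v : C -> R) (h : C -> C) : Prop :=
  holomorphic h /\ Rbar_lt (norm_v v h) p_infty.

(* [Rpower 0 m = 1] for every [m], hence the separate case: here
   [rpow 0 m = 0], the right value for [m > 0]. *)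
Definition rpow (r m : R) : R := if Rlt_dec 0 r then Rpower r m else 0.

(* The profile of [v] on [0,1], extended by [v(1) = 0]. *)
Definition profile01 (v : C -> R) (r : R) : R :=
  if Rlt_dec r 1 then v (RtoC r) else 0.

Definition is_max_point (v : C -> R) (m r : R) : Prop :=
  0 <= r <= 1 /\
  forall s, 0 <= s <= 1 ->
    rpow s m * profile01 v s <= rpow r m * profile01 v r.

(* Maximum points need not be unique: [rm] is some fixed selection of them.
   They always lie in (0,1), so the quotients and powers below are genuine. *)
Definition condition_B (v : C -> R) : Prop :=
  exists rm : R -> R,
    (forall m, 0 < m -> is_max_point v m (rm m)) /\
    forall b1, 1 < b1 -> exists b2, 1 < b2 /\ exists c, 0 < c /\
      forall m n, 0 < m -> 0 < n ->
        rpow (rm m / rm n) m * (profile01 v (rm m) / profile01 v (rm n)) <= b1 ->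
        c <= m -> c <= n -> c <= Rabs (m - n) ->
        rpow (rm n / rm m) n * (profile01 v (rm n) / profile01 v (rm m)) <= b2.

(* The exponent [n - n^eps] may be negative, which makes the numerator improper
   at 0; a divergent integral counts as [+oo], so convergence is demanded. *)
Definition moment_condition (v : C -> R) (eps : R) : Prop :=
  exists M : R, forall n : nat, (1 <= n)%nat ->
    exists I : R,
      is_RInt_gen (fun r => Rpower r (INR n - Rpower (INR n) eps) * v (RtoC r))
        (at_right 0) (at_left 1) I /\
      I / RInt (fun r => r ^ n * v (RtoC r)) 0 1 <= M.

Definition radial (a : C -> C) : Prop :=
  forall z, disc z -> a z = a (RtoC (Cmod z)).

Definition unit_interval (r : R) : Prop := 0 <= r <= 1.

(* One-sided derivatives at the end points. *)
Definition C1_on_unit_interval (f : R -> C) : Prop :=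
  exists f' : R -> C,
    (forall x, unit_interval x ->
       @filterdiff R_AbsRing R_NormedModule C_R_NormedModule
         f (within unit_interval (locally x)) (fun y => scal y (f' x))) /\
    @continuous_on R_UniformSpace C_UniformSpace unit_interval f'.

(* A symbol lives on the open disc, so that being C^1 on the closed interval
   means that its profile on [0,1) extends to a C^1 function on [0,1]. *)
Definition C1_symbol (a : C -> C) : Prop :=
  exists f : R -> C, C1_on_unit_interval f /\
    forall r, 0 <= r < 1 -> a (RtoC r) = f r.

Definition toeplitz_coeff (v : C -> R) (a : C -> C) (n : nat) : C :=
  Cdiv
    (@RInt C_R_CompleteNormedModule
       (fun r => Cmult (RtoC (r ^ (2 * n + 1) * v (RtoC r))) (a (RtoC r))) 0 1)
    (RtoC (RInt (fun r => r ^ (2 * n + 1) * v (RtoC r)) 0 1)).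

(* [g = T_a h] on the disc, for a radial symbol [a]: the projection of [a * h]
   onto the holomorphic functions is then the Taylor multiplier below, and this
   formula also makes sense for the [h] in [H_v] that are not in [L^2_v].  The
   coefficients [c] are those of the (unique) Taylor expansion of [h] at 0. *)
Definition is_toeplitz (v : C -> R) (a : C -> C) (h g : C -> C) : Prop :=
  exists c : nat -> C, forall z, disc z ->
    @is_pseries C_AbsRing C_NormedModule c z (h z) /\
    @is_pseries C_AbsRing C_NormedModule
      (fun n => Cmult (toeplitz_coeff v a n) (c n)) z (g z).

(* [T_a] maps all of [H_v] into [H_v] and is bounded for the norm [norm_v]. *)
Definition toeplitz_bounded (v : C -> R) (a : C -> C) : Prop :=
  exists K : R, forall h, H_v v h ->
    exists g, is_toeplitz v a h g /\ H_v v g /\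
      real (norm_v v g) <= K * real (norm_v v h).

(* Main.v *)
Require Import Defs.
From Stdlib Require Import Reals Lra Lia Arith Classical ClassicalEpsilon.
From Coquelicot Require Import Coquelicot.
(* [Reals] exports another [disc]. *)
Import Defs.
Open Scope R_scope.

(** The coefficients [gamma_n] are averages of the symbol against the probability
    densities proportional to [r^(2n+1) v(r)].  Let [rho_n] be the average of [r]
    itself.  For a real [L]-Lipschitz symbol [p], both [L r + p] and [L r - p] are
    nondecreasing, and averages of nondecreasing functions grow with [n] by
    Chebyshev's association inequality, so [|gamma_(n+1) - gamma_n|] is at most
    [L (rho_(n+1) - rho_n)].  Since [r^(-s) >= s (1 - r)], the moment condition
    bounds [1 - rho_n] by [M n^(-eps)].

    The [N]-th partial sum of the Taylor series of [h] at [z] is at most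
    [4 + 2 ln (N+1)] times the maximum of [|h|] on the circle [|w| = |z|], whatever
    the weight.  By Abel summation [T_a h] is [lim gamma_n] times [h] minus
    [sum_N (gamma_(N+1) - gamma_N) S_N h], and this is bounded because
    [sum_N (rho_(N+1) - rho_N) ln (N+1)] is finite.

    The Taylor expansion of a pointwise complex differentiable function is obtained
    from Goursat's lemma. *)

(** * Complex paths and Goursat's lemma *)

(** The obstacle is that Taylor partial sums are not uniformly bounded on circles, so every
    increment of [gamma] costs a logarithm, while no rate is known for a single [rho_(n+1) - rho_n]:
    only the tail [1 - rho_n] is known to decay. The sum therefore has to telescope. One square root
    of [1 - rho_n] absorbs the logarithm and the other one telescopes, so any positive eps is
    enough. The point z is compared only with the points of its own circle, where v has the constant
    value v(|z|). A bound of |T_a h(z)| by the maximum of |h| on that circle is thus already a bound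
    in the weighted norm. [holomorphic] gives a derivative at each point and no continuity of it, so
    Goursat's lemma is proved by bisection. It is set up for a differentiable image of a square,
    because the region between a circle and its contraction towards an interior point is such an
    image. This yields both Cauchy's formula and the independence of the Taylor coefficients from
    the radius. *)

Lemma Cmod_le_abs (z : C) : Cmod z <= Rabs (fst z) + Rabs (snd z).
Proof.
  apply Rsqr_incr_0_var.
  - unfold Cmod; rewrite Rsqr_sqrt; [|nra].
    rewrite <- (pow2_abs (fst z)), <- (pow2_abs (snd z)); unfold Rsqr.
    pose proof (Rabs_pos (fst z)); pose proof (Rabs_pos (snd z)); nra.
  - pose proof (Rabs_pos (fst z)); pose proof (Rabs_pos (snd z)); lra.
Qed.

Lemma abs_fst_le (z : C) : Rabs (fst z) <= Cmod z.
Proof. eapply Rle_trans; [apply Rmax_l | apply Rmax_Cmod]. Qed.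

Lemma abs_snd_le (z : C) : Rabs (snd z) <= Cmod z.
Proof. eapply Rle_trans; [apply Rmax_r | apply Rmax_Cmod]. Qed.

Lemma Cmod_minus_sym (x y : C) : Cmod (x - y) = Cmod (y - x).
Proof. rewrite <- Cmod_opp; f_equal; ring. Qed.

Lemma Cmod_minus_triangle (x y : C) : Cmod x - Cmod y <= Cmod (x - y).
Proof.
  pose proof (Cmod_triangle (x - y) y) as H.
  replace (x - y + y)%C with x in H by ring; lra.
Qed.

(** Continuity, derivatives and integrals of paths are all taken by components, so that each fact
    reduces to two facts about real functions. *)
Definition pcont (f : R -> C) (u : R) : Prop :=
  continuous (fun t => fst (f t)) u /\ continuous (fun t => snd (f t)) u.

Definition pderiv (f : R -> C) (u : R) (l : C) : Prop :=
  is_derive (fun t => fst (f t)) u (fst l) /\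
  is_derive (fun t => snd (f t)) u (snd l).

Definition is_CInt (f : R -> C) (a b : R) (l : C) : Prop :=
  is_RInt (fun t => fst (f t)) a b (fst l) /\
  is_RInt (fun t => snd (f t)) a b (snd l).

Definition CInt (f : R -> C) (a b : R) : C :=
  (RInt (fun t => fst (f t)) a b, RInt (fun t => snd (f t)) a b).

Lemma continuous_eps (f : R -> R) (u : R) :
  continuous f u <->
  forall eps, 0 < eps -> exists d, 0 < d /\
    forall t, Rabs (t - u) < d -> Rabs (f t - f u) < eps.
Proof.
  split.
  - intros H eps Heps.
    assert (H0 : locally (f u) (fun y => Rabs (y - f u) < eps))
      by (exists (mkposreal eps Heps); intros y Hy; exact Hy).
    destruct (H _ H0) as [d Hd].
    exists d; split; [apply cond_pos | intros t Ht; apply Hd; exact Ht].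
  - intros H P [eps HP].
    destruct (H eps (cond_pos eps)) as [d [Hd Ht]].
    exists (mkposreal d Hd); intros t Htd; apply HP, Ht, Htd.
Qed.

Lemma pcont_eps (f : R -> C) (u : R) :
  pcont f u <->
  forall eps, 0 < eps -> exists d, 0 < d /\
    forall t, Rabs (t - u) < d -> Cmod (f t - f u) < eps.
Proof.
  unfold pcont; rewrite !continuous_eps; split.
  - intros [H1 H2] eps Heps.
    destruct (H1 (eps / 2)) as [d1 [Hd1 K1]]; [lra|].
    destruct (H2 (eps / 2)) as [d2 [Hd2 K2]]; [lra|].
    exists (Rmin d1 d2); split; [apply Rmin_glb_lt; lra|].
    intros t Ht.
    eapply Rle_lt_trans; [apply Cmod_le_abs|].
    assert (Rabs (t - u) < d1) by (eapply Rlt_le_trans; [exact Ht | apply Rmin_l]).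
    assert (Rabs (t - u) < d2) by (eapply Rlt_le_trans; [exact Ht | apply Rmin_r]).
    specialize (K1 t ltac:(assumption)); specialize (K2 t ltac:(assumption)).
    simpl; unfold Rminus in *; lra.
  - intros H; split; intros eps Heps; destruct (H eps Heps) as [d [Hd K]];
      exists d; split; auto; intros t Ht; specialize (K t Ht);
      eapply Rle_lt_trans; [|exact K| |exact K].
    + exact (abs_fst_le (f t - f u)).
    + exact (abs_snd_le (f t - f u)).
Qed.

Lemma pcont_const (c : C) (u : R) : pcont (fun _ => c) u.
Proof. split; apply continuous_const. Qed.

Lemma pcont_plus (f g : R -> C) (u : R) :
  pcont f u -> pcont g u -> pcont (fun t => f t + g t)%C u.
Proof.
  intros [F1 F2] [G1 G2]; split; simpl;
    [apply (continuous_plus _ _ _ F1 G1) | apply (continuous_plus _ _ _ F2 G2)].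
Qed.

Lemma pcont_minus (f g : R -> C) (u : R) :
  pcont f u -> pcont g u -> pcont (fun t => f t - g t)%C u.
Proof.
  intros [F1 F2] [G1 G2]; split; simpl;
    [apply (continuous_minus _ _ _ F1 G1) | apply (continuous_minus _ _ _ F2 G2)].
Qed.

Lemma pcont_mult (f g : R -> C) (u : R) :
  pcont f u -> pcont g u -> pcont (fun t => f t * g t)%C u.
Proof.
  intros [F1 F2] [G1 G2]; split; simpl.
  - apply (continuous_minus (V := R_NormedModule));
      apply (continuous_mult (K := R_AbsRing)); assumption.
  - apply (continuous_plus (V := R_NormedModule));
      apply (continuous_mult (K := R_AbsRing)); assumption.
Qed.

Lemma pcont_pow (f : R -> C) (n : nat) (u : R) :
  pcont f u -> pcont (fun t => f t ^ n)%C u.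
Proof.
  intros Hf; induction n as [|n IH]; simpl.
  - apply pcont_const.
  - apply pcont_mult; assumption.
Qed.

Lemma pcont_inv (f : R -> C) (u : R) :
  pcont f u -> f u <> 0 -> pcont (fun t => / f t)%C u.
Proof.
  intros [F1 F2] Hn.
  assert (Hd : fst (f u) ^ 2 + snd (f u) ^ 2 <> 0).
  { intros H; apply Hn, Cmod_eq_0; unfold Cmod; rewrite H; apply sqrt_0. }
  assert (Hc : continuous (fun t => / (fst (f t) ^ 2 + snd (f t) ^ 2)) u).
  { apply continuous_Rinv_comp; [|exact Hd].
    apply (continuous_plus (fun t => fst (f t) ^ 2) (fun t => snd (f t) ^ 2));
      simpl; apply (continuous_mult (K := R_AbsRing)); try assumption;
      apply (continuous_mult (K := R_AbsRing)); try assumption;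
      apply continuous_const. }
  split; simpl; unfold Rdiv; apply (continuous_mult (K := R_AbsRing));
    try assumption.
  apply (continuous_opp (V := R_NormedModule)); assumption.
Qed.

Lemma pderiv_cont (f : R -> C) (u : R) (l : C) : pderiv f u l -> pcont f u.
Proof.
  intros [H1 H2]; split;
    apply (ex_derive_continuous (V := R_NormedModule)); eexists; eassumption.
Qed.

Lemma is_CInt_unique (f : R -> C) (a b : R) (l : C) :
  is_CInt f a b l -> CInt f a b = l.
Proof.
  intros [H1 H2]; unfold CInt.
  rewrite (is_RInt_unique _ _ _ _ H1), (is_RInt_unique _ _ _ _ H2).
  now destruct l.
Qed.

Lemma CInt_correct (f : R -> C) (a b : R) :
  a <= b -> (forall t, a <= t <= b -> pcont f t) -> is_CInt f a b (CInt f a b).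
Proof.
  intros Hab Hf; split; simpl;
    apply (RInt_correct (V := R_CompleteNormedModule)), ex_RInt_continuous;
    intros t; rewrite Rmin_left, Rmax_right by assumption; intros Ht;
    apply (Hf t Ht).
Qed.

Lemma is_CInt_ext (f g : R -> C) (a b : R) (l : C) :
  a <= b -> (forall t, a <= t <= b -> f t = g t) -> is_CInt f a b l -> is_CInt g a b l.
Proof.
  intros Hab H [H1 H2]; split;
    [eapply is_RInt_ext; [|exact H1] | eapply is_RInt_ext; [|exact H2]];
    intros t; rewrite Rmin_left, Rmax_right by assumption; intros Ht;
    rewrite H by lra; reflexivity.
Qed.

Lemma CInt_ext (f g : R -> C) (a b : R) :
  a <= b -> (forall t, a <= t <= b -> f t = g t) -> CInt f a b = CInt g a b.
Proof.
  intros Hab H; unfold CInt; f_equal; apply RInt_ext; intros t;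
    rewrite Rmin_left, Rmax_right by assumption; intros Ht; rewrite H by lra; reflexivity.
Qed.

Lemma is_CInt_plus (f g : R -> C) (a b : R) (l m : C) :
  is_CInt f a b l -> is_CInt g a b m ->
  is_CInt (fun t => f t + g t)%C a b (l + m)%C.
Proof.
  intros [F1 F2] [G1 G2]; split; simpl;
    [apply (is_RInt_plus _ _ _ _ _ _ F1 G1) | apply (is_RInt_plus _ _ _ _ _ _ F2 G2)].
Qed.

Lemma is_CInt_minus (f g : R -> C) (a b : R) (l m : C) :
  is_CInt f a b l -> is_CInt g a b m ->
  is_CInt (fun t => f t - g t)%C a b (l - m)%C.
Proof.
  intros [F1 F2] [G1 G2]; split; simpl;
    [apply (is_RInt_minus _ _ _ _ _ _ F1 G1) | apply (is_RInt_minus _ _ _ _ _ _ F2 G2)].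
Qed.

Lemma is_CInt_scal (c : C) (f : R -> C) (a b : R) (l : C) :
  is_CInt f a b l -> is_CInt (fun t => c * f t)%C a b (c * l)%C.
Proof.
  intros [F1 F2]; split; simpl.
  - apply (is_RInt_minus (V := R_NormedModule));
      apply (is_RInt_scal (V := R_NormedModule)); assumption.
  - apply (is_RInt_plus (V := R_NormedModule));
      apply (is_RInt_scal (V := R_NormedModule)); assumption.
Qed.

Lemma is_CInt_Chasles (f : R -> C) (a b c : R) (l m : C) :
  is_CInt f a b l -> is_CInt f b c m -> is_CInt f a c (l + m)%C.
Proof.
  intros [F1 F2] [G1 G2]; split; simpl;
    [apply (is_RInt_Chasles _ _ _ _ _ _ F1 G1) | apply (is_RInt_Chasles _ _ _ _ _ _ F2 G2)].
Qed.

Lemma is_CInt_derive (f df : R -> C) (a b : R) :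
  a <= b -> (forall t, a <= t <= b -> pderiv f t (df t)) ->
  (forall t, a <= t <= b -> pcont df t) ->
  is_CInt df a b (f b - f a)%C.
Proof.
  intros Hab Hd Hc; split;
    [apply (is_RInt_derive (V := R_CompleteNormedModule) (fun t => fst (f t)))
    |apply (is_RInt_derive (V := R_CompleteNormedModule) (fun t => snd (f t)))];
    intros t; rewrite Rmin_left, Rmax_right by assumption; intros Ht;
    (apply (Hd t Ht) || apply (Hc t Ht)).
Qed.

(** The factor 2 comes from estimating the two components separately; the sharp constant 1 would
    gain nothing below. *)
Lemma CInt_bound (f : R -> C) (a b B : R) (l : C) :
  a <= b -> (forall t, a <= t <= b -> Cmod (f t) <= B) ->
  is_CInt f a b l -> Cmod l <= 2 * B * (b - a).
Proof.
  intros Hab HB [H1 H2].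
  assert (Hc : is_RInt (fun _ => B) a b ((b - a) * B))
    by apply (is_RInt_const (V := R_NormedModule)).
  assert (K1 : norm (fst l) <= (b - a) * B).
  { apply (norm_RInt_le _ _ a b _ _ Hab) with (2 := H1) (3 := Hc).
    intros t Ht; eapply Rle_trans; [apply (abs_fst_le (f t)) | auto]. }
  assert (K2 : norm (snd l) <= (b - a) * B).
  { apply (norm_RInt_le _ _ a b _ _ Hab) with (2 := H2) (3 := Hc).
    intros t Ht; eapply Rle_trans; [apply (abs_snd_le (f t)) | auto]. }
  change (norm (fst l)) with (Rabs (fst l)) in K1.
  change (norm (snd l)) with (Rabs (snd l)) in K2.
  pose proof (Cmod_le_abs l); lra.
Qed.

(** This is the form in which Goursat's lemma consumes differentiability: an affine approximation
    with error o(|w - w0|). *)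
Definition cderiv (F : C -> C) (w0 D : C) : Prop :=
  forall eps, 0 < eps -> exists d, 0 < d /\
    forall w, Cmod (w - w0) < d ->
      Cmod (F w - F w0 - D * (w - w0)) <= eps * Cmod (w - w0).

Lemma is_derive_cderiv (F : C -> C) (w0 D : C) :
  @is_derive C_AbsRing C_NormedModule F w0 D <-> cderiv F w0 D.
Proof.
  split.
  - intros [_ H] eps Heps.
    assert (Hl : is_filter_lim (@locally (AbsRing_UniformSpace C_AbsRing) w0) w0)
      by (intros P HP; exact HP).
    destruct (H w0 Hl (mkposreal eps Heps)) as [d Hd].
    exists d; split; [apply cond_pos|].
    intros w Hw; specialize (Hd w Hw); simpl in Hd.
    replace (D * (w - w0))%C with ((w - w0) * D)%C by ring.
    exact Hd.
  - intros H; split; [apply is_linear_scal_l|].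
    intros x Hx; apply (is_filter_lim_locally_unique (V := AbsRing_NormedModule C_AbsRing)) in Hx.
    subst x; intros eps.
    destruct (H eps (cond_pos eps)) as [d [Hd K]].
    exists (mkposreal d Hd); intros w Hw; specialize (K w Hw).
    replace (D * (w - w0))%C with ((w - w0) * D)%C in K by ring.
    exact K.
Qed.

Lemma cderiv_cont (F : C -> C) (w0 D : C) :
  cderiv F w0 D -> forall eps, 0 < eps -> exists d, 0 < d /\
    forall w, Cmod (w - w0) < d -> Cmod (F w - F w0) < eps.
Proof.
  intros H eps Heps.
  destruct (H 1 Rlt_0_1) as [d [Hd K]].
  pose proof (Cmod_ge_0 D) as HD.
  exists (Rmin d (eps / (2 + Cmod D))); split.
  - apply Rmin_glb_lt; [lra | apply Rdiv_lt_0_compat; lra].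
  - intros w Hw.
    assert (Hw1 : Cmod (w - w0) < d) by (eapply Rlt_le_trans; [exact Hw | apply Rmin_l]).
    assert (Hw2 : Cmod (w - w0) < eps / (2 + Cmod D))
      by (eapply Rlt_le_trans; [exact Hw | apply Rmin_r]).
    apply Rlt_div_r in Hw2; [|lra].
    specialize (K w Hw1).
    replace (F w - F w0)%C with ((F w - F w0 - D * (w - w0)) + D * (w - w0))%C by ring.
    eapply Rle_lt_trans; [apply Cmod_triangle|]; rewrite Cmod_mult.
    pose proof (Cmod_ge_0 (w - w0)); nra.
Qed.

Lemma pcont_comp (F : C -> C) (g : R -> C) (u : R) (D : C) :
  cderiv F (g u) D -> pcont g u -> pcont (fun t => F (g t)) u.
Proof.
  intros HF Hg; apply pcont_eps; intros eps Heps.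
  destruct (cderiv_cont _ _ _ HF eps Heps) as [d [Hd K]].
  destruct (proj1 (pcont_eps _ _) Hg d Hd) as [d' [Hd' K']].
  exists d'; split; auto.
Qed.

(** * Bisection of the unit square *)

Lemma nested_intervals (x s : nat -> R) :
  (forall n, 0 <= s n) -> (forall n, x n <= x (S n)) ->
  (forall n, x (S n) + s (S n) <= x n + s n) ->
  exists X, forall n, x n <= X <= x n + s n.
Proof.
  intros Hs Hx Hy.
  assert (Hx' : forall n k, x n <= x (n + k)%nat).
  { intros n k; induction k as [|k IH]; [rewrite Nat.add_0_r; lra|].
    rewrite Nat.add_succ_r; eapply Rle_trans; [exact IH | apply Hx]. }
  assert (Hy' : forall n k, x (n + k)%nat + s (n + k)%nat <= x n + s n).
  { intros n k; induction k as [|k IH]; [rewrite Nat.add_0_r; lra|].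
    rewrite Nat.add_succ_r; eapply Rle_trans; [apply Hy | exact IH]. }
  assert (Hxy : forall n m, x m <= x n + s n).
  { intros n m; destruct (Nat.le_ge_cases m n) as [H|H].
    - replace n with (m + (n - m))%nat by lia.
      pose proof (Hx' m (n - m)%nat); pose proof (Hs (m + (n - m))%nat); lra.
    - replace m with (n + (m - n))%nat by lia.
      pose proof (Hy' n (m - n)%nat); pose proof (Hs (n + (m - n))%nat); lra. }
  destruct (completeness (fun r => exists n, r = x n)) as [X [H1 H2]].
  - exists (x 0%nat + s 0%nat); intros r [n ->]; apply Hxy.
  - exists (x 0%nat), 0%nat; reflexivity.
  - exists X; intros n; split.
    + apply H1; exists n; reflexivity.
    + apply H2; intros r [m ->]; apply Hxy.
Qed.

(** Cousin's lemma by contradiction: a square on which [P] fails has a quarter on which it fails,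
    and the failing squares shrink to a point where the second hypothesis is violated. That
    hypothesis covers all small squares containing the point, since its position inside them is not
    controlled. *)
Lemma square_cousin (P : R -> R -> R -> Prop) :
  (forall x y s, 0 < s -> P x y (s / 2) -> P (x + s / 2) y (s / 2) ->
     P x (y + s / 2) (s / 2) -> P (x + s / 2) (y + s / 2) (s / 2) -> P x y s) ->
  (forall x y, 0 <= x <= 1 -> 0 <= y <= 1 -> exists d, 0 < d /\
     forall x' y' s, 0 < s < d -> x' <= x <= x' + s -> y' <= y <= y' + s -> P x' y' s) ->
  P 0 0 1.
Proof.
  intros Hsub Hloc; apply NNPP; intros Hnot.
  (* [step] moves to a quarter where [P] fails. The upper right one is the default: if the other
     three satisfy [P], it must fail. *)
  set (step := fun q : R * R * R =>
    let '(x, y, s) := q in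
    if excluded_middle_informative (P x y (s / 2)) then
    if excluded_middle_informative (P (x + s / 2) y (s / 2)) then
    if excluded_middle_informative (P x (y + s / 2) (s / 2)) then
      (x + s / 2, y + s / 2, s / 2)
    else (x, y + s / 2, s / 2)
    else (x + s / 2, y, s / 2)
    else (x, y, s / 2)).
  set (q := fun n => Nat.iter n step (0, 0, 1)).
  set (qx := fun n => fst (fst (q n))); set (qy := fun n => snd (fst (q n))).
  set (qs := fun n => snd (q n)).
  assert (Hq : forall n, ~ P (qx n) (qy n) (qs n) /\ 0 < qs n).
  { induction n as [|n [IH1 IH2]]; [split; [exact Hnot | unfold qs; simpl; lra]|].
    unfold qx, qy, qs in *; simpl; fold (q n).
    destruct (q n) as [[x y] s]; simpl in *.
    destruct excluded_middle_informative; simpl; [|split; [assumption | lra]].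
    destruct excluded_middle_informative; simpl; [|split; [assumption | lra]].
    destruct excluded_middle_informative; simpl; [|split; [assumption | lra]].
    split; [|lra]; intros H; apply IH1, Hsub; assumption. }
  assert (Hstep : forall n, qs (S n) = qs n / 2 /\
     qx n <= qx (S n) <= qx n + qs n / 2 /\ qy n <= qy (S n) <= qy n + qs n / 2).
  { intros n; pose proof (proj2 (Hq n)) as Hp.
    unfold qx, qy, qs in *; simpl; fold (q n).
    destruct (q n) as [[x y] s]; simpl in *.
    repeat destruct excluded_middle_informative; simpl; lra. }
  assert (Hqs : forall n, qs n = (/ 2) ^ n).
  { induction n as [|n IH]; [reflexivity|].
    rewrite (proj1 (Hstep n)), IH; simpl; field. }
  destruct (nested_intervals qx qs) as [X HX];
    [intros n; pose proof (Hq n); pose proof (Hstep n); lra..|].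
  destruct (nested_intervals qy qs) as [Y HY];
    [intros n; pose proof (Hq n); pose proof (Hstep n); lra..|].
  destruct (Hloc X Y) as [d [Hd K]].
  { pose proof (HX 0%nat) as H; unfold qx, qs, q in H; simpl in H; lra. }
  { pose proof (HY 0%nat) as H; unfold qy, qs, q in H; simpl in H; lra. }
  destruct (pow_lt_1_zero (/ 2)) with (y := d) as [N HN];
    [rewrite Rabs_pos_eq; lra | exact Hd |].
  specialize (HN N (le_n N)); rewrite <- Hqs, Rabs_pos_eq in HN
    by (pose proof (Hq N); lra).
  apply (proj1 (Hq N)), K; auto.
  pose proof (Hq N); lra.
Qed.

Lemma pderiv_mult (f g : R -> C) (u : R) (l m : C) :
  pderiv f u l -> pderiv g u m ->
  pderiv (fun t => f t * g t)%C u (l * g u + f u * m)%C.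
Proof.
  intros [F1 F2] [G1 G2].
  assert (H : forall (p q : R -> R) a b, is_derive p u a -> is_derive q u b ->
    is_derive (fun t => p t * q t) u (a * q u + p u * b))
    by (intros p q a b Hp Hq; apply (is_derive_mult p q u a b Hp Hq), Rmult_comm).
  split.
  - pose proof (is_derive_minus _ _ _ _ _ (H _ _ _ _ F1 G1) (H _ _ _ _ F2 G2)) as K.
    simpl; match type of K with is_derive _ _ ?v => match goal with |- is_derive _ _ ?w => replace w with v end end;
      [exact K|].
    unfold minus, plus, opp; simpl; ring.
  - pose proof (is_derive_plus _ _ _ _ _ (H _ _ _ _ F1 G2) (H _ _ _ _ F2 G1)) as K.
    simpl; match type of K with is_derive _ _ ?v => match goal with |- is_derive _ _ ?w => replace w with v end end;
      [exact K|].
    unfold plus; simpl; ring.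
Qed.

Lemma pderiv_plus (f g : R -> C) (u : R) (l m : C) :
  pderiv f u l -> pderiv g u m -> pderiv (fun t => f t + g t)%C u (l + m)%C.
Proof.
  intros [F1 F2] [G1 G2]; split;
    [apply (is_derive_plus _ _ _ _ _ F1 G1) | apply (is_derive_plus _ _ _ _ _ F2 G2)].
Qed.

Lemma pderiv_const (c : C) (u : R) : pderiv (fun _ => c) u (RtoC 0).
Proof.
  split; [apply (is_derive_const (V := R_NormedModule) (fst c))
         | apply (is_derive_const (V := R_NormedModule) (snd c))].
Qed.

(** The quadratic expression is a primitive of F0 + D (w - w0), so integrals of affine functions
    depend only on the end points of the path. *)
Lemma pderiv_quadratic (F0 D w0 : C) (g : R -> C) (u : R) (l : C) :
  pderiv g u l ->
  pderiv (fun t => F0 * (g t - w0) + D / RtoC 2 * ((g t - w0) * (g t - w0)))%C u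
    ((F0 + D * (g u - w0)) * l)%C.
Proof.
  intros H.
  pose proof (pderiv_plus _ _ _ _ _ H (pderiv_const (- w0) u)) as K.
  pose proof (pderiv_plus _ _ _ _ _ (pderiv_mult _ _ _ _ _ (pderiv_const F0 u) K)
    (pderiv_mult _ _ _ _ _ (pderiv_const (D / RtoC 2) u) (pderiv_mult _ _ _ _ _ K K))) as L.
  match type of L with pderiv _ _ ?v => replace ((F0 + D * (g u - w0)) * l)%C with v end;
    [exact L | field].
Qed.

(** Around a closed contour the increments of the primitive [A] disappear, and only the error of the
    affine approximation times the length is left. *)
Lemma path_integral_affine (F : C -> C) (g g' : R -> C) (a b : R) (F0 D w0 : C)
    (eta K : R) :
  a <= b ->
  (forall u, a <= u <= b -> pderiv g u (g' u)) ->
  (forall u, a <= u <= b -> pcont g' u) ->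
  (forall u, a <= u <= b -> pcont (fun t => F (g t)) u) ->
  (forall u, a <= u <= b -> Cmod (g' u) <= K) ->
  (forall u, a <= u <= b -> Cmod (F (g u) - (F0 + D * (g u - w0))) <= eta) ->
  let A w := (F0 * (w - w0) + D / RtoC 2 * ((w - w0) * (w - w0)))%C in
  Cmod (CInt (fun u => F (g u) * g' u)%C a b - (A (g b) - A (g a)))
    <= 2 * (eta * K) * (b - a).
Proof.
  intros Hab Hd Hc HF HK He A.
  assert (I1 : is_CInt (fun u => F (g u) * g' u)%C a b (CInt (fun u => F (g u) * g' u)%C a b))
    by (apply CInt_correct; auto; intros; apply pcont_mult; auto).
  assert (I2 : is_CInt (fun u => (F0 + D * (g u - w0)) * g' u)%C a b (A (g b) - A (g a))%C).
  { apply (is_CInt_derive (fun u => A (g u))); auto.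
    - intros t Ht; apply pderiv_quadratic; auto.
    - intros t Ht; pose proof (pderiv_cont _ _ _ (Hd t Ht)).
      apply (pcont_mult (fun u => F0 + D * (g u - w0))%C g'); [|auto].
      apply (pcont_plus (fun _ => F0) (fun u => D * (g u - w0))%C); [apply pcont_const|].
      apply (pcont_mult (fun _ => D) (fun u => g u - w0)%C); [apply pcont_const|].
      apply (pcont_minus g (fun _ => w0)); [assumption | apply pcont_const]. }
  eapply CInt_bound; [exact Hab | | exact (is_CInt_minus _ _ _ _ _ _ I1 I2)].
  intros t Ht; simpl.
  replace (F (g t) * g' t - (F0 + D * (g t - w0)) * g' t)%C
    with ((F (g t) - (F0 + D * (g t - w0))) * g' t)%C by ring.
  rewrite Cmod_mult.
  apply Rmult_le_compat; auto; apply Cmod_ge_0.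
Qed.

Lemma path_lipschitz (g g' : R -> C) (a b K : R) :
  a <= b -> (forall u, a <= u <= b -> pderiv g u (g' u)) ->
  (forall u, a <= u <= b -> pcont g' u) ->
  (forall u, a <= u <= b -> Cmod (g' u) <= K) ->
  Cmod (g b - g a) <= 2 * K * (b - a).
Proof.
  intros Hab Hd Hc HK.
  apply (CInt_bound g'); auto; apply is_CInt_derive; auto.
Qed.

Lemma Cmod_sum4 (a b c d : C) (B : R) :
  Cmod a <= B -> Cmod b <= B -> Cmod c <= B -> Cmod d <= B ->
  Cmod (a + b + c + d) <= 4 * B.
Proof.
  intros.
  pose proof (Cmod_triangle (a + b + c) d); pose proof (Cmod_triangle (a + b) c).
  pose proof (Cmod_triangle a b); lra.
Qed.

(** The contour integral [J] over a parameter square of side s is shown to be at most eps s^2, a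
    bound that passes from the quarters to the whole because [J] is additive. Near a point the
    affine part of [F] integrates to 0 and the rest is o(s) on a contour of length O(s); the bound
    [K] transfers both sizes from the parameters to the plane. *)
Lemma goursat (F : C -> C) (Phi Phix Phiy : R -> R -> C) (K : R) :
  (forall x y, pderiv (fun t => Phi t y) x (Phix x y)) ->
  (forall x y, pderiv (fun t => Phi x t) y (Phiy x y)) ->
  (forall x y, pcont (fun t => Phix t y) x) ->
  (forall x y, pcont (fun t => Phiy x t) y) ->
  (forall x y, 0 <= x <= 1 -> 0 <= y <= 1 -> Cmod (Phix x y) <= K) ->
  (forall x y, 0 <= x <= 1 -> 0 <= y <= 1 -> Cmod (Phiy x y) <= K) ->
  (forall x y, 0 <= x <= 1 -> 0 <= y <= 1 -> exists D, cderiv F (Phi x y) D) ->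
  (CInt (fun u => F (Phi u 0) * Phix u 0) 0 1
   + CInt (fun u => F (Phi 1 u) * Phiy 1 u) 0 1
   - CInt (fun u => F (Phi u 1) * Phix u 1) 0 1
   - CInt (fun u => F (Phi 0 u) * Phiy 0 u) 0 1)%C = RtoC 0.
Proof.
  intros Hx Hy Cx Cy Kx Ky HF.
  set (hor := fun y => CInt (fun u => F (Phi u y) * Phix u y)%C).
  set (ver := fun x => CInt (fun u => F (Phi x u) * Phiy x u)%C).
  set (J := fun x y s : R => (hor y x (x + s)%R + ver (x + s)%R y (y + s)%R
                          - hor (y + s)%R x (x + s)%R - ver x y (y + s)%R)%C).
  assert (HFx : forall x y, 0 <= x <= 1 -> 0 <= y <= 1 -> pcont (fun t => F (Phi t y)) x).
  { intros x y X Y; destruct (HF x y X Y) as [D HD].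
    apply (pcont_comp F (fun t => Phi t y) x D HD).
    eapply pderiv_cont; apply Hx. }
  assert (HFy : forall x y, 0 <= x <= 1 -> 0 <= y <= 1 -> pcont (fun t => F (Phi x t)) y).
  { intros x y X Y; destruct (HF x y X Y) as [D HD].
    apply (pcont_comp F (fun t => Phi x t) y D HD).
    eapply pderiv_cont; apply Hy. }
  assert (chas_h : forall y a b c, 0 <= y <= 1 -> 0 <= a -> a <= b -> b <= c -> c <= 1 ->
     hor y a c = (hor y a b + hor y b c)%C).
  { intros; unfold hor; apply is_CInt_unique; eapply is_CInt_Chasles;
      apply CInt_correct; auto; intros; apply pcont_mult; auto; apply HFx; lra. }
  assert (chas_v : forall x a b c, 0 <= x <= 1 -> 0 <= a -> a <= b -> b <= c -> c <= 1 ->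
     ver x a c = (ver x a b + ver x b c)%C).
  { intros; unfold ver; apply is_CInt_unique; eapply is_CInt_Chasles;
      apply CInt_correct; auto; intros; apply pcont_mult; auto; apply HFy; lra. }
  assert (HK : 0 <= K)
    by (eapply Rle_trans; [apply Cmod_ge_0 | apply (Kx 0 0); lra]).
  assert (Hsmall : forall eps, 0 < eps -> Cmod (J 0 0 1) <= eps).
  { intros eps Heps.
    (* The claim carries the hypothesis that the square lies in the unit square, because
       [square_cousin] also offers squares that stick out, where nothing is known about [F]. *)
    cut (0 <= 0 -> 0 <= 0 -> 0 + 1 <= 1 -> 0 + 1 <= 1 -> Cmod (J 0 0 1) <= eps * (1 * 1));
      [intros H; rewrite !Rmult_1_r in H; apply H; lra|].
    apply (square_cousin (fun x y s => 0 <= x -> 0 <= y -> x + s <= 1 -> y + s <= 1 ->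
      Cmod (J x y s) <= eps * (s * s))).
    - intros x y s Hs P1 P2 P3 P4 X0 Y0 X1 Y1.
      assert (E : J x y s = (J x y (s / 2)%R + J (x + s / 2)%R y (s / 2)%R
         + J x (y + s / 2)%R (s / 2)%R + J (x + s / 2)%R (y + s / 2)%R (s / 2)%R)%C).
      { unfold J.
        replace (x + s / 2 + s / 2) with (x + s) by field.
        replace (y + s / 2 + s / 2) with (y + s) by field.
        rewrite (chas_h y x (x + s / 2) (x + s)) by lra.
        rewrite (chas_h (y + s) x (x + s / 2) (x + s)) by lra.
        rewrite (chas_v x y (y + s / 2) (y + s)) by lra.
        rewrite (chas_v (x + s) y (y + s / 2) (y + s)) by lra.
        ring. }
      rewrite E; replace (eps * (s * s)) with (4 * (eps * (s / 2 * (s / 2)))) by field.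
      apply Cmod_sum4; [apply P1 | apply P2 | apply P3 | apply P4]; lra.
    - intros x0 y0 X0 Y0; set (w0 := Phi x0 y0).
      destruct (HF x0 y0 X0 Y0) as [D HD].
      (* Image points are within 4 K s of [w0], so each side errs by at most 2 [eta] K s with [eta]
         = 4 K s eps / (32 (K + 1)^2). The four sides add up to eps s^2 (K / (K + 1))^2. Using K + 1
         avoids a division by zero, and s < d / (4 (K + 1)) keeps 4 K s below d. *)
      destruct (HD (eps / (32 * (K + 1) * (K + 1)))) as [d [Hd HD']].
      { apply Rdiv_lt_0_compat; nra. }
      exists (d / (4 * (K + 1))); split; [apply Rdiv_lt_0_compat; lra|].
      intros x y s [Hs1 Hs2] Hxs Hys Hx0 Hy0 Hx1 Hy1.
      apply Rlt_div_r in Hs2; [|lra].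
      assert (Hlip : forall x' y', x <= x' <= x + s -> y <= y' <= y + s ->
         Cmod (Phi x' y' - w0) <= 4 * K * s).
      { intros x' y' Hx' Hy'; unfold w0.
        replace (Phi x' y' - Phi x0 y0)%C
          with ((Phi x' y' - Phi x0 y') + (Phi x0 y' - Phi x0 y0))%C by ring.
        eapply Rle_trans; [apply Cmod_triangle|].
        assert (A1 : Cmod (Phi x' y' - Phi x0 y') <= 2 * K * s).
        { destruct (Rle_lt_dec x0 x') as [H|H].
          - eapply Rle_trans; [apply (path_lipschitz (fun t => Phi t y') (fun t => Phix t y') _ _ K)|];
              auto; [intros; apply Kx; lra | nra].
          - rewrite Cmod_minus_sym.
            eapply Rle_trans; [apply (path_lipschitz (fun t => Phi t y') (fun t => Phix t y') _ _ K)|];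
              auto; [lra | intros; apply Kx; lra | nra]. }
        assert (A2 : Cmod (Phi x0 y' - Phi x0 y0) <= 2 * K * s).
        { destruct (Rle_lt_dec y0 y') as [H|H].
          - eapply Rle_trans; [apply (path_lipschitz (fun t => Phi x0 t) (fun t => Phiy x0 t) _ _ K)|];
              auto; [intros; apply Ky; lra | nra].
          - rewrite Cmod_minus_sym.
            eapply Rle_trans; [apply (path_lipschitz (fun t => Phi x0 t) (fun t => Phiy x0 t) _ _ K)|];
              auto; [lra | intros; apply Ky; lra | nra]. }
        lra. }
      set (eta := eps / (32 * (K + 1) * (K + 1)) * (4 * K * s)).
      assert (Heta : forall x' y', x <= x' <= x + s -> y <= y' <= y + s ->
         Cmod (F (Phi x' y') - (F w0 + D * (Phi x' y' - w0))) <= eta).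
      { intros x' y' Hx' Hy'; specialize (Hlip x' y' Hx' Hy').
        replace (F (Phi x' y') - (F w0 + D * (Phi x' y' - w0)))%C
          with (F (Phi x' y') - F w0 - D * (Phi x' y' - w0))%C by ring.
        eapply Rle_trans; [apply HD'|].
        - fold w0; nra.
        - apply Rmult_le_compat_l; [|exact Hlip].
          apply Rlt_le, Rdiv_lt_0_compat; nra. }
      set (A := fun w => (F w0 * (w - w0) + D / RtoC 2 * ((w - w0) * (w - w0)))%C).
      assert (Bh : forall y', y <= y' <= y + s ->
         Cmod (hor y' x (x + s)%R - (A (Phi (x + s)%R y') - A (Phi x y'))) <= 2 * (eta * K) * s).
      { intros y' Hy'; replace s with (x + s - x) at 3 by ring.
        apply (path_integral_affine F (fun u => Phi u y') (fun u => Phix u y'));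
          auto; intros; try lra; first [apply HFx; lra | apply Kx; lra]. }
      assert (Bv : forall x', x <= x' <= x + s ->
         Cmod (ver x' y (y + s)%R - (A (Phi x' (y + s)%R) - A (Phi x' y))) <= 2 * (eta * K) * s).
      { intros x' Hx'; replace s with (y + s - y) at 3 by ring.
        apply (path_integral_affine F (fun u => Phi x' u) (fun u => Phiy x' u));
          auto; intros; try lra; first [apply HFy; lra | apply Ky; lra]. }
      (* The increments of [A] along the four sides add up to 0, so they can be inserted. *)
      assert (E : J x y s =
        ((hor y x (x + s)%R - (A (Phi (x + s)%R y) - A (Phi x y)))
         + (ver (x + s)%R y (y + s)%R - (A (Phi (x + s)%R (y + s)%R) - A (Phi (x + s)%R y)))
         + - (hor (y + s)%R x (x + s)%R - (A (Phi (x + s)%R (y + s)%R) - A (Phi x (y + s)%R)))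
         + - (ver x y (y + s)%R - (A (Phi x (y + s)%R) - A (Phi x y))))%C)
        by (unfold J; ring).
      rewrite E; eapply Rle_trans; [apply (Cmod_sum4 _ _ _ _ (2 * (eta * K) * s))|];
        rewrite ?Cmod_opp; [apply Bh; lra | apply Bv; lra | apply Bh; lra | apply Bv; lra |].
      replace (4 * (2 * (eta * K) * s))
        with (eps * (s * s) * (K / (K + 1) * (K / (K + 1)))) by (unfold eta; field; lra).
      assert (0 <= K / (K + 1) <= 1).
      { split; [apply Rdiv_le_0_compat; lra|].
        apply Rle_div_l; lra. }
      assert (0 <= eps * (s * s)) by nra.
      assert (K / (K + 1) * (K / (K + 1)) <= 1) by nra.
      nra. }
  assert (HJ : Cmod (J 0 0 1) = 0).
  { apply Rle_antisym; [|apply Cmod_ge_0].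
    apply le_epsilon; intros eps Heps; rewrite Rplus_0_l; auto. }
  apply Cmod_eq_0 in HJ; unfold J, hor, ver in HJ.
  rewrite !Rplus_0_l in HJ; exact HJ.
Qed.

(** * Circles and complex derivatives *)

Definition csum (a : nat -> C) (n : nat) : C := @sum_n C_Ring a n.

Lemma csum_0 (a : nat -> C) : csum a 0 = a 0%nat.
Proof. unfold csum; rewrite sum_O; reflexivity. Qed.

Lemma csum_S (a : nat -> C) (n : nat) : csum a (S n) = (csum a n + a (S n))%C.
Proof. unfold csum; rewrite sum_Sn; reflexivity. Qed.

Lemma csum_ext (a b : nat -> C) (n : nat) :
  (forall k, (k <= n)%nat -> a k = b k) -> csum a n = csum b n.
Proof. intros H; apply sum_n_ext_loc; exact H. Qed.

Lemma pow_n_Cpow (z : C) (n : nat) : @pow_n C_Ring z n = (z ^ n)%C.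
Proof. induction n as [|n IH]; [reflexivity | simpl; rewrite IH; reflexivity]. Qed.

Definition conv (a : nat -> C) (l : C) : Prop :=
  forall eps, 0 < eps -> exists N, forall n, (N <= n)%nat -> Cmod (csum a n - l) < eps.

Lemma is_pseries_conv (c : nat -> C) (z l : C) :
  @is_pseries C_AbsRing C_NormedModule c z l <-> conv (fun k => z ^ k * c k)%C l.
Proof.
  assert (E : forall n, sum_n (G := C_NormedModule)
      (fun k => scal (pow_n (K := C_AbsRing) z k) (c k)) n
      = csum (fun k => z ^ k * c k)%C n).
  { intros n; apply sum_n_ext; intros k.
    change (@pow_n C_AbsRing z k) with (@pow_n C_Ring z k).
    rewrite pow_n_Cpow; reflexivity. }
  unfold is_pseries, is_series; split.
  - intros H eps Heps.
    pose proof (proj1 (filterlim_locally_ball_norm (U := C_NormedModule) _ l) H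
      (mkposreal eps Heps)) as [N HN].
    exists N; intros n Hn; specialize (HN n Hn).
    rewrite <- E; exact HN.
  - intros H; apply filterlim_locally_ball_norm; intros eps.
    destruct (H eps (cond_pos eps)) as [N HN].
    exists N; intros n Hn; unfold ball_norm; rewrite E; exact (HN n Hn).
Qed.

(** * Points and frequencies on the unit circle *)

Definition cis (t : R) : C := (cos t, sin t).

Lemma Cmod_cis (t : R) : Cmod (cis t) = 1.
Proof.
  unfold Cmod, cis; simpl.
  replace (cos t * (cos t * 1) + sin t * (sin t * 1)) with 1; [apply sqrt_1|].
  pose proof (sin2_cos2 t) as H; unfold Rsqr in H; lra.
Qed.

Lemma cis_plus (s t : R) : cis (s + t) = (cis s * cis t)%C.
Proof.
  unfold cis, Cmult; simpl; rewrite cos_plus, sin_plus; f_equal; ring.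
Qed.

Lemma cis_0 : cis 0 = 1.
Proof. unfold cis; rewrite cos_0, sin_0; reflexivity. Qed.

Lemma cis_neq_0 (t : R) : cis t <> 0.
Proof. apply Cmod_gt_0; rewrite Cmod_cis; lra. Qed.

Lemma cis_opp (t : R) : cis (- t) = (/ cis t)%C.
Proof.
  assert (H : (cis (- t) * cis t)%C = 1)
    by (rewrite <- cis_plus, Rplus_opp_l; apply cis_0).
  replace (cis (- t)) with (cis (- t) * cis t * / cis t)%C
    by (field; apply cis_neq_0).
  rewrite H; ring.
Qed.

Lemma cis_pow (t : R) (n : nat) : (cis t ^ n)%C = cis (INR n * t).
Proof.
  induction n as [|n IH].
  - simpl; rewrite Rmult_0_l, cis_0; reflexivity.
  - rewrite Cpow_S, IH, <- cis_plus, S_INR; f_equal; ring.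
Qed.

Lemma cis_period (t : R) (k : nat) : cis (t + 2 * INR k * PI) = cis t.
Proof. unfold cis; rewrite cos_period, sin_period; reflexivity. Qed.

Lemma cis_2PI (k : nat) : cis (2 * INR k * PI) = 1.
Proof.
  rewrite <- (Rplus_0_l (2 * INR k * PI)), cis_period; apply cis_0.
Qed.

Lemma pderiv_cis (a t : R) :
  pderiv (fun y => cis (a * y)) t (RtoC a * Ci * cis (a * t))%C.
Proof. split; simpl; auto_derive; auto; ring. Qed.

Lemma pcont_cis (a t : R) : pcont (fun y => cis (a * y)) t.
Proof. eapply pderiv_cont, pderiv_cis. Qed.

(** One turn takes the parameter from 0 to 1, so that circles fit the parameter square of [goursat]
    and integrals over them are averages. *)
Definition unit_point (y : R) : C := cis (2 * PI * y).

Lemma Cmod_unit_point (y : R) : Cmod (unit_point y) = 1.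
Proof. apply Cmod_cis. Qed.

Lemma unit_point_neq_0 (y : R) : unit_point y <> 0.
Proof. apply cis_neq_0. Qed.

Lemma pcont_unit_point (t : R) : pcont unit_point t.
Proof. exact (pcont_cis (2 * PI) t). Qed.

Lemma unit_point_1 : unit_point 1 = 1.
Proof.
  unfold unit_point; replace (2 * PI * 1) with (2 * INR 1 * PI) by (simpl; ring).
  apply cis_2PI.
Qed.

Lemma unit_point_0 : unit_point 0 = 1.
Proof. unfold unit_point; rewrite Rmult_0_r; apply cis_0. Qed.

(** The frequency is a nonzero integer, so the integrand has a primitive of period 1. *)
Lemma is_CInt_cis_period (n : nat) :
  is_CInt (fun y => cis (- (2 * INR (S n) * PI) * y)) 0 1 0.
Proof.
  set (a := - (2 * INR (S n) * PI)).
  assert (Ha : a <> 0).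
  { unfold a; pose proof PI_RGT_0; pose proof (lt_0_INR (S n) ltac:(lia)); nra. }
  assert (Hc : (RtoC a * Ci)%C <> 0).
  { apply Cmod_gt_0; rewrite Cmod_mult, Cmod_Ci, Cmod_R.
    apply Rabs_pos_lt in Ha; lra. }
  pose proof (is_CInt_derive (fun y => cis (a * y)) (fun y => RtoC a * Ci * cis (a * y))%C
    0 1 Rle_0_1 (fun t _ => pderiv_cis a t)
    (fun t _ => pcont_mult _ _ _ (pcont_const _ _) (pcont_cis a t))) as H.
  apply (is_CInt_scal (/ (RtoC a * Ci))) in H.
  replace (cis (a * 1) - cis (a * 0))%C with (RtoC 0) in H.
  - rewrite Cmult_0_r in H.
    eapply is_CInt_ext; [lra | | exact H].
    intros t _; simpl; field.
    split; intros E; apply Hc; rewrite E; ring.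
  - rewrite Rmult_0_r, Rmult_1_r, cis_0; unfold a.
    rewrite cis_opp, cis_2PI; field.
Qed.

(* Goursat on the annular region swept when the circle is shrunk by the factor [tau]
   towards [z0]; the two radial sides of the parameter square cancel. *)
Lemma circle_homotopy (F : C -> C) (z0 : C) (r tau : R) :
  0 < r -> 0 < tau <= 1 ->
  (forall t y, tau <= t <= 1 -> exists D, cderiv F (z0 + RtoC t * (RtoC r * unit_point y - z0))%C D) ->
  CInt (fun y => F (RtoC r * unit_point y) * unit_point y)%C 0 1 =
  (RtoC tau * CInt (fun y => F (z0 + RtoC tau * (RtoC r * unit_point y - z0)) * unit_point y) 0 1)%C.
Proof.
  intros Hr Ht HF.
  (* Parameter 1 gives the original circle and parameter 0 the contracted one. *)
  set (s := fun x : R => (tau + (1 - tau) * x)%R).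
  set (Phi := fun x y => (z0 + RtoC (s x) * (RtoC r * unit_point y - z0))%C).
  set (Phix := fun (x y : R) => (RtoC (1 - tau) * (RtoC r * unit_point y - z0))%C).
  (* [k * unit_point y] is the velocity of the circle. The factor [k] occurs on both circles and is
     divided out at the end, which is why the conclusion contains [unit_point y] alone. *)
  set (k := (RtoC (2 * PI) * Ci * RtoC r)%C).
  set (Phiy := fun x y => (RtoC (s x) * (k * unit_point y))%C).
  assert (Hs : forall x, pderiv (fun t => RtoC (s t)) x (RtoC (1 - tau))).
  { intros x; split; simpl; unfold s; auto_derive; auto; ring. }
  assert (He : forall y, pderiv (fun t => RtoC r * unit_point t - z0)%C y (k * unit_point y)%C).
  { intros y.
    pose proof (pderiv_plus _ _ _ _ _ (pderiv_mult _ _ _ _ _ (pderiv_const (RtoC r) y)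
      (pderiv_cis (2 * PI) y)) (pderiv_const (- z0) y)) as H.
    match type of H with pderiv _ _ ?v => replace (k * unit_point y)%C with v end;
      [exact H | unfold k, unit_point; ring]. }
  assert (Hz : forall y, Cmod (RtoC r * unit_point y - z0) <= r + Cmod z0).
  { intros y; eapply Rle_trans; [apply Cmod_triangle|].
    rewrite Cmod_opp, Cmod_mult, Cmod_unit_point, Cmod_R, Rabs_pos_eq; lra. }
  pose proof (Cmod_ge_0 z0) as Hz0.
  assert (Hk : Cmod k = 2 * PI * r).
  { unfold k; rewrite !Cmod_mult, Cmod_Ci, !Cmod_R, !Rabs_pos_eq; try lra.
    pose proof PI_RGT_0; lra. }
  assert (Hs01 : forall x, 0 <= x <= 1 -> tau <= s x <= 1) by (intros x Hx; unfold s; nra).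
  pose proof (goursat F Phi Phix Phiy (r + Cmod z0 + 2 * PI * r)) as G.
  pose proof PI_RGT_0 as HPI.
  assert (HPr : 0 < PI * r) by nra.
  assert (E1 : CInt (fun u => F (Phi 1 u) * Phiy 1 u)%C 0 1
    = (k * CInt (fun y => F (RtoC r * unit_point y) * unit_point y) 0 1)%C).
  { assert (S1 : s 1 = 1) by (unfold s; ring).
    apply is_CInt_unique.
    eapply (is_CInt_ext (fun y => k * (F (RtoC r * unit_point y) * unit_point y))%C); [lra | |].
    - intros y _; unfold Phi, Phiy; rewrite S1.
      replace (z0 + RtoC 1 * (RtoC r * unit_point y - z0))%C with (RtoC r * unit_point y)%C by ring.
      ring.
    - apply is_CInt_scal, CInt_correct; [lra|]; intros y _.
      apply pcont_mult; [|apply pcont_unit_point].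
      destruct (HF 1 y) as [D HD]; [lra|].
      replace (z0 + RtoC 1 * (RtoC r * unit_point y - z0))%C with (RtoC r * unit_point y)%C in HD by ring.
      apply (pcont_comp F (fun y => RtoC r * unit_point y)%C y D HD).
      apply pcont_mult; [apply pcont_const | apply pcont_unit_point]. }
  assert (E0 : CInt (fun u => F (Phi 0 u) * Phiy 0 u)%C 0 1
    = (k * (RtoC tau * CInt (fun y => F (z0 + RtoC tau * (RtoC r * unit_point y - z0)) * unit_point y) 0 1))%C).
  { assert (S0 : s 0 = tau) by (unfold s; ring).
    rewrite Cmult_assoc; apply is_CInt_unique.
    eapply (is_CInt_ext (fun y => (k * RtoC tau) *
      (F (z0 + RtoC tau * (RtoC r * unit_point y - z0)) * unit_point y))%C); [lra | |].
    - intros y _; unfold Phi, Phiy; rewrite S0; ring.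
    - apply is_CInt_scal, CInt_correct; [lra|]; intros y _.
      apply pcont_mult; [|apply pcont_unit_point].
      destruct (HF tau y) as [D HD]; [lra|].
      apply (pcont_comp F (fun y => z0 + RtoC tau * (RtoC r * unit_point y - z0))%C y D HD).
      apply (pcont_plus (fun _ => z0)); [apply pcont_const|].
      apply pcont_mult; [apply pcont_const|].
      eapply pderiv_cont, He. }
  assert (Eh : CInt (fun u => F (Phi u 0) * Phix u 0)%C 0 1
    = CInt (fun u => F (Phi u 1) * Phix u 1)%C 0 1).
  { apply CInt_ext; [lra|]; intros u _; unfold Phi, Phix; rewrite unit_point_0, unit_point_1; reflexivity. }
  assert (G' : (CInt (fun u => F (Phi u 0%R) * Phix u 0%R) 0 1
   + CInt (fun u => F (Phi 1%R u) * Phiy 1%R u) 0 1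
   - CInt (fun u => F (Phi u 1%R) * Phix u 1%R) 0 1
   - CInt (fun u => F (Phi 0%R u) * Phiy 0%R u) 0 1)%C = RtoC 0).
  { apply G.
    - intros x y.
      pose proof (pderiv_plus _ _ _ _ _ (pderiv_const z0 x)
        (pderiv_mult _ _ _ _ _ (Hs x) (pderiv_const (RtoC r * unit_point y - z0)%C x))) as H.
      match type of H with pderiv _ _ ?v => replace (Phix x y) with v end;
        [exact H | unfold Phix; ring].
    - intros x y.
      pose proof (pderiv_plus _ _ _ _ _ (pderiv_const z0 y)
        (pderiv_mult _ _ _ _ _ (pderiv_const (RtoC (s x)) y) (He y))) as H.
      match type of H with pderiv _ _ ?v => replace (Phiy x y) with v end;
        [exact H | unfold Phiy; ring].
    - intros x y; apply pcont_const.
    - intros x y; unfold Phiy.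
      apply (pcont_mult (fun _ => RtoC (s x))); [apply pcont_const|].
      apply (pcont_mult (fun _ => k)); [apply pcont_const | apply pcont_unit_point].
    - intros x y _ _; unfold Phix.
      rewrite Cmod_mult, Cmod_R, Rabs_pos_eq by lra.
      pose proof (Hz y); pose proof (Cmod_ge_0 (RtoC r * unit_point y - z0)); nra.
    - intros x y Hx _; unfold Phiy.
      specialize (Hs01 x Hx).
      rewrite !Cmod_mult, Cmod_unit_point, Hk, Cmod_R, Rabs_pos_eq by lra.
      nra.
    - intros x y Hx _; apply HF; auto. }
  rewrite E1, E0, Eh in G'.
  assert (Hk0 : k <> 0) by (apply Cmod_gt_0; rewrite Hk; lra).
  set (I1 := CInt (fun y => F (RtoC r * unit_point y) * unit_point y)%C 0 1) in *.
  set (I0 := CInt (fun y => F (z0 + RtoC tau * (RtoC r * unit_point y - z0)) * unit_point y)%C 0 1) in *.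
  set (H0 := CInt (fun u => F (Phi u 1) * Phix u 1)%C 0 1) in *.
  replace I1 with (/ k * (H0 + k * I1 - H0 - k * (RtoC tau * I0)) + RtoC tau * I0)%C
    by (field; auto).
  rewrite G'; ring.
Qed.

(** * Rules for complex derivatives *)

Lemma cderiv_mult (F G : C -> C) (w0 D E : C) :
  cderiv F w0 D -> cderiv G w0 E ->
  cderiv (fun w => F w * G w)%C w0 (D * G w0 + F w0 * E)%C.
Proof.
  intros HF HG eps Heps.
  pose proof (Cmod_ge_0 (F w0)); pose proof (Cmod_ge_0 (G w0)); pose proof (Cmod_ge_0 D).
  set (M := 1 + Cmod (G w0) + Cmod (F w0) + Cmod D).
  assert (HM : 0 < M) by (unfold M; lra).
  assert (He1 : 0 < eps / M) by (apply Rdiv_lt_0_compat; lra).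
  destruct (HF _ He1) as [d1 [Hd1 K1]].
  destruct (HG _ He1) as [d2 [Hd2 K2]].
  destruct (cderiv_cont _ _ _ HG 1 Rlt_0_1) as [d3 [Hd3 K3]].
  destruct (cderiv_cont _ _ _ HG _ He1) as [d4 [Hd4 K4]].
  exists (Rmin (Rmin d1 d2) (Rmin d3 d4)); split; [repeat apply Rmin_glb_lt; lra|].
  intros w Hw.
  apply Rmin_Rgt in Hw as [Hw1 Hw2]; apply Rmin_Rgt in Hw1 as [Hw1 Hw1'].
  apply Rmin_Rgt in Hw2 as [Hw2 Hw2'].
  specialize (K1 w Hw1); specialize (K2 w Hw1'); specialize (K3 w Hw2); specialize (K4 w Hw2').
  replace (F w * G w - F w0 * G w0 - (D * G w0 + F w0 * E) * (w - w0))%C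
    with ((F w - F w0 - D * (w - w0)) * G w + F w0 * (G w - G w0 - E * (w - w0))
          + D * (w - w0) * (G w - G w0))%C by ring.
  assert (HGw : Cmod (G w) <= 1 + Cmod (G w0))
    by (pose proof (Cmod_minus_triangle (G w) (G w0)); lra).
  eapply Rle_trans; [apply Cmod_triangle|].
  eapply Rle_trans; [apply Rplus_le_compat_r, Cmod_triangle|].
  rewrite !Cmod_mult.
  set (d := Cmod (w - w0)) in *.
  assert (Hd : 0 <= d) by apply Cmod_ge_0.
  replace (eps * d) with (eps / M * d * (1 + Cmod (G w0)) + Cmod (F w0) * (eps / M * d)
    + Cmod D * d * (eps / M)) by (unfold M; field; unfold M in HM; lra).
  assert (0 <= eps / M * d) by nra.
  pose proof (Cmod_ge_0 (G w)); pose proof (Cmod_ge_0 (F w - F w0 - D * (w - w0))).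
  repeat apply Rplus_le_compat.
  - apply Rmult_le_compat; auto.
  - apply Rmult_le_compat_l; auto.
  - apply Rmult_le_compat_l; [apply Rmult_le_pos; lra | lra].
Qed.

Lemma cderiv_inv (z0 w0 : C) :
  w0 <> z0 -> cderiv (fun w => / (w - z0))%C w0 (- / ((w0 - z0) * (w0 - z0)))%C.
Proof.
  intros Hne eps Heps.
  assert (Hnz : (w0 - z0)%C <> 0) by (intros H; apply Hne; replace w0 with ((w0 - z0) + z0)%C by ring; rewrite H; ring).
  assert (Hm : 0 < Cmod (w0 - z0)) by (apply Cmod_gt_0; auto).
  set (m := Cmod (w0 - z0)) in *.
  assert (Hm3 : 0 < m * m * m) by (repeat apply Rmult_lt_0_compat; auto).
  (* The first bound keeps |w - z0| >= m / 2, so the error |w - w0|^2 / (m^2 |w - z0|) is at most 2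
     |w - w0|^2 / m^3; the second makes this at most eps |w - w0|. *)
  exists (Rmin (m / 2) (eps * (m * m * m) / 2)); split; [apply Rmin_glb_lt; nra|].
  intros w Hw; apply Rmin_Rgt in Hw as [Hw1 Hw2].
  assert (Hwm : m / 2 <= Cmod (w - z0)).
  { pose proof (Cmod_minus_triangle (w0 - z0) (w - z0)) as H.
    replace (w0 - z0 - (w - z0))%C with (- (w - w0))%C in H by ring.
    rewrite Cmod_opp in H; fold m in H; lra. }
  assert (Hw0 : (w - z0)%C <> 0) by (apply Cmod_gt_0; lra).
  replace (/ (w - z0) - / (w0 - z0) - - / ((w0 - z0) * (w0 - z0)) * (w - w0))%C
    with ((w - w0) * (w - w0) / ((w0 - z0) * (w0 - z0) * (w - z0)))%C by (field; auto).
  rewrite Cmod_div by (repeat apply Cmult_neq_0; auto).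
  rewrite !Cmod_mult; fold m.
  set (d := Cmod (w - w0)) in *.
  assert (Hd : 0 <= d) by apply Cmod_ge_0.
  apply Rle_div_l; [apply Rmult_lt_0_compat; nra|].
  assert (m * m * (m / 2) <= m * m * Cmod (w - z0)) by (apply Rmult_le_compat_l; nra).
  assert (d * d <= d * (eps * (m * m * m) / 2)) by (apply Rmult_le_compat_l; lra).
  assert (eps * d * (m * m * (m / 2)) <= eps * d * (m * m * Cmod (w - z0)))
    by (apply Rmult_le_compat_l; nra).
  lra.
Qed.

Lemma cderiv_ext (F G : C -> C) (w0 D : C) :
  (forall w, F w = G w) -> cderiv F w0 D -> cderiv G w0 D.
Proof.
  intros E H eps Heps; destruct (H eps Heps) as [d [Hd K]].
  exists d; split; auto; intros w Hw; rewrite <- !E; auto.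
Qed.

Lemma cderiv_inv_pow (n : nat) (w0 : C) :
  w0 <> 0 -> exists D, cderiv (fun w => (/ w) ^ n)%C w0 D.
Proof.
  intros H0; induction n as [|n [D IH]].
  - exists 0; intros eps Heps; exists 1; split; [lra|]; intros w _; simpl.
    replace (RtoC 1 - RtoC 1 - RtoC 0 * (w - w0))%C with (RtoC 0) by ring.
    rewrite Cmod_0; pose proof (Cmod_ge_0 (w - w0)); nra.
  - eexists; simpl; apply cderiv_mult; [|exact IH].
    eapply cderiv_ext; [|apply (cderiv_inv 0)]; [|exact H0].
    intros w; simpl; f_equal; ring.
Qed.

(** * Cauchy's formula and the Taylor expansion *)

(** Cauchy's formula for the n-th Taylor coefficient at 0: the average of h(w) w^(-n) over the
    circle |w| = r. *)
Definition circle_coef (h : C -> C) (r : R) (n : nat) : C :=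
  CInt (fun y => h (RtoC r * unit_point y) * (/ (RtoC r * unit_point y)) ^ n)%C 0 1.

Lemma circle_point_neq_0 (r y : R) : 0 < r -> (RtoC r * unit_point y)%C <> 0.
Proof.
  intros Hr; apply Cmod_gt_0; rewrite Cmod_mult, Cmod_unit_point, Cmod_R, Rabs_pos_eq; lra.
Qed.

Lemma pcont_circle_point (r t : R) : pcont (fun y => RtoC r * unit_point y)%C t.
Proof. apply pcont_mult; [apply pcont_const | apply pcont_unit_point]. Qed.

Lemma pcont_circle_point_inv_pow (r t : R) (n : nat) :
  0 < r -> pcont (fun y => (/ (RtoC r * unit_point y)) ^ n)%C t.
Proof.
  intros Hr; apply (pcont_pow (fun y => / (RtoC r * unit_point y))%C).
  apply pcont_inv; [apply pcont_circle_point | apply circle_point_neq_0; auto].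
Qed.

Lemma Cmod_circle_point (r y : R) : 0 < r -> Cmod (RtoC r * unit_point y) = r.
Proof. intros Hr; rewrite Cmod_mult, Cmod_unit_point, Cmod_R, Rabs_pos_eq; lra. Qed.

Definition cdiff_disc (h : C -> C) : Prop :=
  forall z, Cmod z < 1 -> exists D, cderiv h z D.

(** The circle is contracted towards 0 for the function h(w) w^(-n-1), whose singularity 0 is never
    reached because tau > 0. The additional power of w cancels the velocity factor [unit_point]. *)
Lemma circle_coef_indep (h : C -> C) (r tau : R) (n : nat) :
  cdiff_disc h -> 0 < r < 1 -> 0 < tau <= 1 ->
  circle_coef h r n = circle_coef h (tau * r) n.
Proof.
  intros Hh Hr Ht.
  pose proof (circle_homotopy (fun w => h w * (/ w) ^ (S n))%C 0 r tau) as H.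
  specialize (H ltac:(lra) Ht).
  assert (E : forall t y, (RtoC 0 + RtoC t * (RtoC r * unit_point y - RtoC 0))%C = (RtoC (t * r) * unit_point y)%C)
    by (intros; rewrite RtoC_mult; ring).
  assert (HD : forall t y, tau <= t <= 1 -> exists D : C,
      cderiv (fun w => h w * (/ w) ^ S n)%C (RtoC 0 + RtoC t * (RtoC r * unit_point y - RtoC 0))%C D).
  { intros t y Ht'; rewrite E.
    assert (0 < t * r < 1) by nra.
    destruct (Hh (RtoC (t * r) * unit_point y)%C) as [D1 H1]; [rewrite Cmod_circle_point; lra|].
    destruct (cderiv_inv_pow (S n) (RtoC (t * r) * unit_point y)%C) as [D2 H2];
      [apply circle_point_neq_0; lra|].
    eexists; apply cderiv_mult; eassumption. }
  specialize (H HD); cbv beta in H.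
  assert (K : forall t, tau <= t <= 1 ->
     CInt (fun y => h (RtoC (t * r) * unit_point y) * (/ (RtoC (t * r) * unit_point y)) ^ S n * unit_point y)%C 0 1
     = (/ RtoC (t * r) * circle_coef h (t * r) n)%C).
  { intros t Ht'; assert (0 < t * r < 1) by nra.
    apply is_CInt_unique.
    eapply (is_CInt_ext (fun y => / RtoC (t * r) *
        (h (RtoC (t * r) * unit_point y) * (/ (RtoC (t * r) * unit_point y)) ^ n))%C); [lra| |].
    - intros y _; rewrite Cpow_S; field; split; [apply unit_point_neq_0|].
      intros Z; apply RtoC_inj in Z; lra.
    - apply is_CInt_scal, CInt_correct; [lra|]; intros y _.
      apply pcont_mult; [|apply pcont_circle_point_inv_pow; lra].
      destruct (Hh (RtoC (t * r) * unit_point y)%C) as [D1 H1]; [rewrite Cmod_circle_point; lra|].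
      eapply (pcont_comp h (fun y => RtoC (t * r) * unit_point y)%C); [exact H1 | apply pcont_circle_point]. }
  pose proof (K 1 ltac:(lra)) as K1; rewrite Rmult_1_l in K1.
  cbv beta in H; rewrite K1 in H.
  erewrite CInt_ext in H;
    [rewrite (K tau) in H by lra | lra | intros y _; cbv beta; rewrite E; reflexivity].
  assert (Hr0 : RtoC r <> 0) by (intros Z; apply RtoC_inj in Z; lra).
  assert (Ht0 : RtoC tau <> 0) by (intros Z; apply RtoC_inj in Z; lra).
  replace (circle_coef h r n) with (RtoC r * (/ RtoC r * circle_coef h r n))%C by (field; auto).
  rewrite H, RtoC_mult; field; auto.
Qed.

(* The difference quotient of [h] is bounded near [z0], so its integral over the
   shrunk circle tends to 0. *)
Lemma cauchy_difference (h : C -> C) (r : R) (z0 : C) :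
  cdiff_disc h -> 0 < r < 1 -> Cmod z0 < r ->
  CInt (fun y => (h (RtoC r * unit_point y) - h z0) * / (RtoC r * unit_point y - z0) * unit_point y)%C 0 1 = 0.
Proof.
  intros Hh Hr Hz0.
  pose proof (Cmod_ge_0 z0) as Hz0'.
  destruct (Hh z0) as [D HD]; [lra|].
  destruct (HD 1 Rlt_0_1) as [d [Hd K]].
  set (q := fun w => ((h w - h z0) * / (w - z0))%C).
  assert (Hne : forall t y, 0 < t -> (RtoC t * (RtoC r * unit_point y - z0))%C <> 0).
  { intros t y Ht; apply Cmult_neq_0; [intros Z; apply RtoC_inj in Z; lra|].
    apply Cmod_gt_0; pose proof (Cmod_minus_triangle (RtoC r * unit_point y) z0) as H.
    rewrite Cmod_circle_point in H; lra. }
  assert (Hz : forall y, Cmod (RtoC r * unit_point y - z0) <= 2).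
  { intros y; eapply Rle_trans; [apply Cmod_triangle|].
    rewrite Cmod_opp, Cmod_circle_point; lra. }
  set (P := fun tau y => (z0 + RtoC tau * (RtoC r * unit_point y - z0))%C).
  assert (HP : forall t y, 0 < t <= 1 -> exists E, cderiv q (P t y) E).
  { intros t y Ht.
    destruct (Hh (P t y)) as [E HE].
    - unfold P.
      replace (z0 + RtoC t * (RtoC r * unit_point y - z0))%C
        with (RtoC (1 - t) * z0 + RtoC t * (RtoC r * unit_point y))%C by (rewrite RtoC_minus; ring).
      eapply Rle_lt_trans; [apply Cmod_triangle|].
      rewrite !(Cmod_mult (RtoC _)), Cmod_unit_point, !Cmod_R, !Rabs_pos_eq by lra; nra.
    - eexists; apply cderiv_mult; [|apply cderiv_inv].
      + instantiate (1 := E); intros eps Heps; destruct (HE eps Heps) as [d' [Hd' K']].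
        exists d'; split; auto; intros w Hw.
        replace (h w - h z0 - (h (P t y) - h z0) - E * (w - P t y))%C
          with (h w - h (P t y) - E * (w - P t y))%C by ring; auto.
      + intros Z; apply (Hne t y); [lra|].
        replace (RtoC t * (RtoC r * unit_point y - z0))%C with (P t y - z0)%C by (unfold P; ring).
        rewrite Z; ring. }
  assert (Hall : forall tau, 0 < tau <= 1 ->
     CInt (fun y => q (RtoC r * unit_point y) * unit_point y)%C 0 1
     = (RtoC tau * CInt (fun y => q (P tau y) * unit_point y) 0 1)%C).
  { intros tau Ht; apply circle_homotopy; auto; [lra|].
    intros t y Hty; apply HP; lra. }
  change (CInt (fun y => q (RtoC r * unit_point y) * unit_point y)%C 0 1 = 0).
  apply Cmod_eq_0, Rle_antisym; [|apply Cmod_ge_0].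
  apply le_epsilon; intros eps Heps; rewrite Rplus_0_l.
  pose proof (Cmod_ge_0 D) as HD0.
  (* The contracted circle lies within 2 tau < d of z0, so the difference quotient on it is at most
     |D| + 1 and its integral at most 2 (|D| + 1). The last bound on [tau] brings the product below
     eps. *)
  set (tau := Rmin 1 (Rmin (d / 4) (eps / (2 * (Cmod D + 1))))).
  assert (He2 : 0 < eps / (2 * (Cmod D + 1))) by (apply Rdiv_lt_0_compat; lra).
  assert (T0 : 0 < tau) by (unfold tau; repeat apply Rmin_glb_lt; lra).
  assert (T1 : tau <= 1) by apply Rmin_l.
  assert (T2 : tau <= d / 4) by (unfold tau; eapply Rle_trans; [apply Rmin_r | apply Rmin_l]).
  assert (T3 : tau <= eps / (2 * (Cmod D + 1)))
    by (unfold tau; eapply Rle_trans; [apply Rmin_r | apply Rmin_r]).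
  rewrite (Hall tau) by lra.
  rewrite Cmod_mult, Cmod_R, Rabs_pos_eq by lra.
  assert (B : Cmod (CInt (fun y => q (P tau y) * unit_point y)%C 0 1) <= 2 * (Cmod D + 1) * (1 - 0)).
  { apply (CInt_bound (fun y => q (P tau y) * unit_point y)%C); [lra| |].
    - intros y _; rewrite Cmod_mult, Cmod_unit_point, Rmult_1_r.
      assert (Hn := Hne tau y T0).
      set (dw := (RtoC tau * (RtoC r * unit_point y - z0))%C) in *.
      assert (Edw : (P tau y - z0)%C = dw) by (unfold P, dw; ring).
      unfold q; rewrite Cmod_mult, Edw, Cmod_inv by auto.
      assert (Hdw : 0 < Cmod dw) by (apply Cmod_gt_0; auto).
      assert (Hdwd : Cmod dw < d).
      { unfold dw; rewrite Cmod_mult, Cmod_R, Rabs_pos_eq by lra.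
        specialize (Hz y); nra. }
      specialize (K (P tau y)); rewrite Edw in K; specialize (K Hdwd).
      apply (Rmult_le_reg_r (Cmod dw)); [auto|].
      rewrite Rmult_assoc, Rinv_l, Rmult_1_r by lra.
      replace (h (P tau y) - h z0)%C with ((h (P tau y) - h z0 - D * dw) + D * dw)%C by ring.
      eapply Rle_trans; [apply Cmod_triangle|]; rewrite Cmod_mult; lra.
    - apply CInt_correct; [lra|]; intros y _.
      apply pcont_mult; [|apply pcont_unit_point].
      destruct (HP tau y) as [E HE]; [lra|].
      eapply pcont_comp; [exact HE|].
      apply (pcont_plus (fun _ => z0)); [apply pcont_const|].
      apply pcont_mult; [apply pcont_const|].
      apply (pcont_minus (fun y => RtoC r * unit_point y)%C (fun _ => z0));
        [apply pcont_circle_point | apply pcont_const]. }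
  apply Rle_div_r in T3; [|lra].
  pose proof (Cmod_ge_0 (CInt (fun y => q (P tau y) * unit_point y)%C 0 1)); nra.
Qed.

(** These Taylor coefficients of the constant 1 convert the vanishing average for h - h(z0) into an
    expansion of h. *)
Lemma circle_coef_one (r : R) (n : nat) :
  0 < r -> is_CInt (fun y => (/ (RtoC r * unit_point y)) ^ n)%C 0 1 (if n then RtoC 1 else RtoC 0).
Proof.
  intros Hr; destruct n as [|n].
  - assert (H : is_CInt (fun _ => RtoC 1) 0 1 (RtoC 1 - RtoC 0)%C).
    { apply (is_CInt_derive RtoC (fun _ => RtoC 1)); [lra | |].
      - intros x _; split; simpl; auto_derive; auto.
      - intros x _; apply pcont_const. }
    replace (RtoC 1 - RtoC 0)%C with (RtoC 1) in H by ring; exact H.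
  - pose proof (is_CInt_scal ((/ RtoC r) ^ S n) _ _ _ _ (is_CInt_cis_period n)) as H.
    rewrite Cmult_0_r in H.
    eapply is_CInt_ext; [lra | | exact H].
    intros y _; cbv beta.
    replace (/ (RtoC r * unit_point y))%C with (/ RtoC r * / unit_point y)%C
      by (field; split; [apply unit_point_neq_0 | intros Z; apply RtoC_inj in Z; lra]).
    rewrite Cpow_mult_l; f_equal.
    unfold unit_point; rewrite <- cis_opp, cis_pow; f_equal; ring.
Qed.

Lemma pow_small (x eps : R) :
  0 <= x < 1 -> 0 < eps -> exists N, forall n, (N <= n)%nat -> x ^ n < eps.
Proof.
  intros Hx Heps.
  destruct (pow_lt_1_zero x) with (y := eps) as [N HN];
    [rewrite Rabs_pos_eq; lra | exact Heps |].
  exists N; intros n Hn; specialize (HN n Hn).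
  eapply Rle_lt_trans; [apply Rle_abs | exact HN].
Qed.

Lemma bounded_of_pcont (f : R -> C) (a b : R) :
  a <= b -> (forall t, a <= t <= b -> pcont f t) ->
  exists M, forall t, a <= t <= b -> Cmod (f t) <= M.
Proof.
  intros Hab Hf.
  assert (H : forall p : R -> R, (forall t, a <= t <= b -> continuous p t) ->
     exists M, forall t, a <= t <= b -> Rabs (p t) <= M).
  { intros p Hp.
    destruct (continuity_ab_maj (fun t => Rabs (p t)) a b Hab) as [x [Hx _]].
    - intros c Hc; apply continuity_pt_filterlim.
      apply (continuous_comp p Rabs); [apply Hp, Hc | apply continuous_Rabs].
    - exists (Rabs (p x)); exact Hx. }
  destruct (H (fun t => fst (f t))) as [M1 H1]; [intros t Ht; apply (Hf t Ht)|].
  destruct (H (fun t => snd (f t))) as [M2 H2]; [intros t Ht; apply (Hf t Ht)|].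
  exists (M1 + M2); intros t Ht; eapply Rle_trans; [apply Cmod_le_abs|].
  specialize (H1 t Ht); specialize (H2 t Ht); lra.
Qed.

(* With [w] on the circle, [(z0/w)^n w/(w - z0) = (z0/w)^n + (z0/w)^(n+1) w/(w - z0)]
   peels the Taylor terms off [cauchy_difference] one at a time. *)
Lemma taylor_on_circle (h : C -> C) (r : R) (z0 : C) :
  cdiff_disc h -> 0 < r < 1 -> Cmod z0 < r ->
  @is_pseries C_AbsRing C_NormedModule (circle_coef h r) z0 (h z0).
Proof.
  intros Hh Hr Hz0.
  pose proof (Cmod_ge_0 z0) as Hz0'.
  set (w := fun y => (RtoC r * unit_point y)%C).
  set (k := fun y => (h (w y) - h z0)%C).
  assert (Hw0 : forall y, w y <> 0) by (intros y; apply circle_point_neq_0; lra).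
  assert (Hwz : forall y, r - Cmod z0 <= Cmod (w y - z0)).
  { intros y; pose proof (Cmod_minus_triangle (w y) z0) as H; unfold w in *.
    rewrite Cmod_circle_point in H; lra. }
  assert (Hwz0 : forall y, (w y - z0)%C <> 0)
    by (intros y; apply Cmod_gt_0; specialize (Hwz y); lra).
  assert (Hh_cont : forall y, pcont (fun y => h (w y)) y).
  { intros y; destruct (Hh (w y)) as [D1 H1]; [unfold w; rewrite Cmod_circle_point; lra|].
    eapply (pcont_comp h w); [exact H1 | apply pcont_circle_point]. }
  assert (Hk_cont : forall y, pcont k y)
    by (intros y; apply (pcont_minus (fun y => h (w y)) (fun _ => h z0));
          [auto | apply pcont_const]).
  set (K := fun y => (k y * (w y * / (w y - z0)))%C).
  assert (HK_cont : forall y, pcont K y).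
  { intros y; apply pcont_mult; [auto|]; apply pcont_mult; [apply pcont_circle_point|].
    apply pcont_inv; [|apply Hwz0].
    apply (pcont_minus w (fun _ => z0)); [apply pcont_circle_point | apply pcont_const]. }
  set (u := fun (n : nat) y => (z0 ^ n * (/ w y) ^ n)%C).
  (* [- Rn (S n)] will be the error of the n-th partial sum at z0. The recursion starts from
     [Rn 0 = 0], which is [cauchy_difference]. *)
  set (Rn := fun n => CInt (fun y => K y * u n y)%C 0 1).
  assert (Hu_cont : forall n y, pcont (u n) y).
  { intros n y; apply (pcont_mult (fun _ => z0 ^ n)%C (fun y => (/ w y) ^ n)%C);
      [apply pcont_const | apply pcont_circle_point_inv_pow; lra]. }
  assert (HRn : forall n, is_CInt (fun y => K y * u n y)%C 0 1 (Rn n)).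
  { intros n; apply CInt_correct; [lra|]; intros y _; apply pcont_mult; auto. }
  assert (R0 : Rn 0%nat = 0).
  { pose proof (cauchy_difference h r z0 Hh Hr Hz0) as H.
    replace (RtoC 0) with (RtoC r * RtoC 0)%C by ring.
    rewrite <- H; apply is_CInt_unique.
    eapply is_CInt_ext; [lra| |apply is_CInt_scal, CInt_correct; [lra|]].
    - intros y _; unfold K, u, k, w; simpl; ring.
    - intros y _; apply pcont_mult; [|apply pcont_unit_point].
      apply (pcont_mult k); [auto|].
      apply pcont_inv; [|apply Hwz0].
      apply (pcont_minus w (fun _ => z0)); [apply pcont_circle_point | apply pcont_const]. }
  (* The n-th Taylor term of h - h(z0); only n = 0 feels the constant. *)
  set (T := fun n : nat => (z0 ^ n * (circle_coef h r n - h z0 * (if n then RtoC 1 else RtoC 0)))%C).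
  assert (HT : forall n, Rn n = (T n + Rn (S n))%C).
  { intros n.
    assert (IT : is_CInt (fun y => k y * u n y)%C 0 1 (T n)).
    { unfold T.
      eapply is_CInt_ext; [lra| | apply is_CInt_scal, is_CInt_minus;
        [|apply is_CInt_scal, (circle_coef_one r n); lra]].
      2: { apply CInt_correct; [lra|]; intros y _.
           apply pcont_mult; [apply Hh_cont | apply pcont_circle_point_inv_pow; lra]. }
      intros y _; unfold k, u, w; ring. }
    apply is_CInt_unique; eapply is_CInt_ext; [lra | | apply is_CInt_plus; [exact IT | apply HRn]].
    intros y _; unfold K, u; rewrite !Cpow_S; field; auto. }
  assert (HS : forall n, csum T n = (- Rn (S n))%C).
  { induction n as [|n IH].
    - rewrite csum_0; pose proof (HT 0%nat) as H; rewrite R0 in H.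
      replace (T 0%nat) with ((T 0%nat + Rn 1%nat) - Rn 1%nat)%C by ring.
      rewrite <- H; ring.
    - rewrite csum_S, IH, (HT (S n)); ring. }
  assert (HS' : forall n, (csum (fun k => z0 ^ k * circle_coef h r k)%C n - h z0)%C = csum T n).
  { induction n as [|n IH].
    - rewrite !csum_0; unfold T; simpl; ring.
    - rewrite !csum_S, <- IH; unfold T; ring. }
  destruct (bounded_of_pcont K 0 1 Rle_0_1 (fun t _ => HK_cont t)) as [B HB].
  assert (HB0 : 0 <= B)
    by (eapply Rle_trans; [apply Cmod_ge_0 | apply (HB 0); lra]).
  (* On the circle |w| = r the factor (z0 / w)^n has modulus x^n, and the other factor [K] is
     bounded independently of n. *)
  set (x := Cmod z0 / r).
  assert (Hx : 0 <= x < 1).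
  { unfold x; split; [apply Rdiv_le_0_compat; lra | apply Rlt_div_l; lra]. }
  assert (Hbound : forall n, Cmod (Rn n) <= 2 * B * x ^ n).
  { intros n; replace (2 * B * x ^ n) with (2 * (B * x ^ n) * (1 - 0)) by ring.
    apply (CInt_bound _ 0 1 (B * x ^ n) (Rn n) Rle_0_1) with (2 := HRn n).
    intros y Hy; rewrite Cmod_mult.
    apply Rmult_le_compat; try apply Cmod_ge_0; [auto|].
    unfold u; rewrite <- Cpow_mult_l, Cmod_pow, Cmod_mult, Cmod_inv by auto.
    unfold w; rewrite Cmod_circle_point by lra; apply Rle_refl. }
  apply is_pseries_conv; intros eps Heps.
  destruct (pow_small x (eps / (2 * B + 1)) Hx) as [N HN];
    [apply Rdiv_lt_0_compat; lra|].
  exists N; intros n Hn.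
  rewrite HS', HS, Cmod_opp.
  eapply Rle_lt_trans; [apply Hbound|].
  specialize (HN (S n) ltac:(lia)).
  apply Rlt_div_r in HN; [|lra].
  pose proof (pow_le x (S n) (proj1 Hx)); nra.
Qed.

(** The coefficients must not depend on z, while [taylor_on_circle] needs a circle around z. The
    radius 1/2 is an arbitrary reference: for larger |z| the circle of radius (1 + |z|) / 2 is used,
    and [circle_coef_indep] identifies its coefficients with those at 1/2. *)
Lemma taylor_disc (h : C -> C) :
  cdiff_disc h -> exists c : nat -> C, forall z, Cmod z < 1 ->
    @is_pseries C_AbsRing C_NormedModule c z (h z).
Proof.
  intros Hh; exists (circle_coef h (1 / 2)); intros z Hz.
  pose proof (Cmod_ge_0 z) as Hz0.
  destruct (Rlt_le_dec (Cmod z) (1 / 2)) as [H|H].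
  - apply taylor_on_circle; auto; lra.
  - set (r := (1 + Cmod z) / 2).
    assert (Hr : 1 / 2 < r < 1) by (unfold r; lra).
    apply is_pseries_conv; intros eps Heps.
    destruct (proj1 (is_pseries_conv _ _ _)
      (taylor_on_circle h r z Hh ltac:(lra) ltac:(unfold r; lra)) eps Heps) as [N HN].
    exists N; intros n Hn; specialize (HN n Hn).
    rewrite (csum_ext _ (fun k => z ^ k * circle_coef h r k)%C); [exact HN|].
    intros k _; f_equal.
    assert (Ht : 0 < 1 / 2 / r <= 1)
      by (split; [apply Rdiv_lt_0_compat; lra | apply Rle_div_l; lra]).
    rewrite (circle_coef_indep h r (1 / 2 / r)); [f_equal; field; lra | auto | lra | auto].
Qed.

(** * Holomorphy of power series *)

Lemma csum_Cmod_le (a : nat -> C) (n : nat) :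
  Cmod (csum a n) <= sum_f_R0 (fun k => Cmod (a k)) n.
Proof.
  induction n as [|n IH]; [rewrite csum_0; apply Rle_refl|].
  rewrite csum_S; simpl; eapply Rle_trans; [apply Cmod_triangle | lra].
Qed.

Lemma csum_scal (z : C) (a : nat -> C) (n : nat) :
  csum (fun k => z * a k)%C n = (z * csum a n)%C.
Proof. exact (sum_n_mult_l (K := C_Ring) z a n). Qed.

Lemma conv_limit_bound (a : nat -> C) (l z : C) (B : R) (n0 : nat) :
  conv a l -> (forall n, (n0 <= n)%nat -> Cmod (csum a n - z) <= B) -> Cmod (l - z) <= B.
Proof.
  intros Ha HB; apply le_epsilon; intros eps Heps.
  destruct (Ha eps Heps) as [N HN].
  specialize (HN (max N n0) ltac:(lia)); specialize (HB (max N n0) ltac:(lia)).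
  rewrite Cmod_minus_sym in HN.
  replace (l - z)%C with ((l - csum a (max N n0)) + (csum a (max N n0) - z))%C by ring.
  eapply Rle_trans; [apply Cmod_triangle | lra].
Qed.

(** The exact value of the geometric sum is kept, since dropping the subtracted power would break
    the induction on k. *)
Lemma geometric_tail (a : nat -> C) (B x : R) (n k : nat) :
  0 <= B -> 0 <= x < 1 -> (forall i, Cmod (a i) <= B * x ^ i) ->
  Cmod (csum a (n + k) - csum a n) <= B / (1 - x) * (x ^ S n - x ^ (S n + k)).
Proof.
  intros HB Hx Ha; induction k as [|k IH].
  - rewrite !Nat.add_0_r.
    replace (csum a n - csum a n)%C with (RtoC 0) by ring; rewrite Cmod_0; lra.
  - rewrite Nat.add_succ_r, csum_S, Nat.add_succ_r.
    replace (csum a (n + k) + a (S (n + k)) - csum a n)%C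
      with ((csum a (n + k) - csum a n) + a (S (n + k)))%C by ring.
    eapply Rle_trans; [apply Cmod_triangle|].
    specialize (Ha (S (n + k))).
    replace (B / (1 - x) * (x ^ S n - x ^ S (S n + k)))
      with (B / (1 - x) * (x ^ S n - x ^ (S n + k)) + B * x ^ S (n + k));
      [lra|].
    change (S n + k)%nat with (S (n + k)); simpl; field; lra.
Qed.

Lemma geometric_conv (a : nat -> C) (B x : R) :
  0 <= x < 1 -> (forall i, Cmod (a i) <= B * x ^ i) ->
  exists l, conv a l /\ forall n, Cmod (csum a n - l) <= B / (1 - x) * x ^ S n.
Proof.
  intros Hx Ha.
  assert (HB : 0 <= B).
  { pose proof (Ha 0%nat) as H; pose proof (Cmod_ge_0 (a 0%nat)); simpl in H; lra. }
  assert (Hex : @ex_series C_AbsRing C_NormedModule a).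
  { apply (ex_series_le (V := C_CompleteNormedModule) a (fun i => B * x ^ i)); [exact Ha|].
    apply (ex_series_scal (V := R_NormedModule) B), ex_series_geom.
    rewrite Rabs_pos_eq; lra. }
  destruct Hex as [l Hl].
  assert (Hc : conv a l).
  { intros eps Heps.
    destruct (proj1 (filterlim_locally_ball_norm (U := C_NormedModule) _ l) Hl
      (mkposreal eps Heps)) as [N HN].
    exists N; exact HN. }
  exists l; split; [exact Hc|]; intros n.
  rewrite Cmod_minus_sym; apply (conv_limit_bound a l _ _ n Hc).
  intros m Hm; replace m with (n + (m - n))%nat by lia.
  eapply Rle_trans; [apply (geometric_tail a B x); auto|].
  apply Rmult_le_compat_l; [apply Rdiv_le_0_compat; lra|].
  pose proof (pow_le x (S n + (m - n)) (proj1 Hx)); lra.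
Qed.

Lemma conv_terms_bounded (a : nat -> C) (l : C) :
  conv a l -> exists B, forall n, Cmod (a n) <= B.
Proof.
  intros Ha; destruct (Ha 1 Rlt_0_1) as [N HN].
  assert (Hfin : exists B, forall n, (n <= N)%nat -> Cmod (a n) <= B).
  { clear; induction N as [|N [B IH]].
    - exists (Cmod (a 0%nat)); intros n Hn; replace n with 0%nat by lia; lra.
    - exists (Rmax B (Cmod (a (S N)))); intros n Hn.
      destruct (Nat.eq_dec n (S N)) as [->|E]; [apply Rmax_r|].
      eapply Rle_trans; [apply IH; lia | apply Rmax_l]. }
  destruct Hfin as [B HB]; exists (Rmax B 2); intros n.
  destruct (Nat.le_gt_cases n N) as [H|H].
  - eapply Rle_trans; [apply HB, H | apply Rmax_l].
  - eapply Rle_trans; [|apply Rmax_r].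
    destruct n as [|n]; [lia|].
    pose proof (HN n ltac:(lia)) as H1; pose proof (HN (S n) ltac:(lia)) as H2.
    rewrite Cmod_minus_sym in H1; rewrite csum_S in H2.
    replace (a (S n)) with ((csum a n + a (S n) - l) + (l - csum a n))%C by ring.
    eapply Rle_trans; [apply Cmod_triangle | lra].
Qed.

(** Equivalent to a radius of convergence of at least 1, in a form visibly stable under
    multiplication by a bounded sequence, as is needed for the coefficients of T_a h. *)
Definition subexponential (c : nat -> C) : Prop :=
  forall s, 0 < s < 1 -> exists B, forall n, Cmod (c n) * s ^ n <= B.

Lemma subexponential_of_conv (c : nat -> C) (h : C -> C) :
  (forall z, Cmod z < 1 -> conv (fun k => z ^ k * c k)%C (h z)) -> subexponential c.
Proof.
  intros H s Hs.
  assert (Hs' : Cmod (RtoC s) = s) by (rewrite Cmod_R, Rabs_pos_eq; lra).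
  destruct (conv_terms_bounded _ _ (H (RtoC s) ltac:(lra))) as [B HB].
  exists B; intros n; specialize (HB n).
  rewrite Cmod_mult, Cmod_pow, Hs' in HB; lra.
Qed.

(** Comparison with a radius s strictly between r and 1 gives the ratio x = r / s; the same [B] and
    [x] serve the whole disc |z| <= r. *)
Lemma subexponential_conv (c : nat -> C) (r : R) :
  subexponential c -> 0 <= r < 1 ->
  exists B x, 0 <= x < 1 /\ forall z, Cmod z <= r -> forall n, Cmod (z ^ n * c n) <= B * x ^ n.
Proof.
  intros Hc Hr; set (s := (1 + r) / 2).
  assert (Hs : r < s < 1) by (unfold s; lra).
  destruct (Hc s) as [B HB]; [lra|].
  exists B, (r / s); split.
  - split; [apply Rdiv_le_0_compat; lra | apply Rlt_div_l; lra].
  - intros z Hz n; rewrite Cmod_mult, Cmod_pow.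
    assert (Hz' : Cmod z ^ n <= r ^ n) by (apply pow_incr; split; [apply Cmod_ge_0 | auto]).
    assert (E : (r / s) ^ n * s ^ n = r ^ n)
      by (rewrite <- Rpow_mult_distr; f_equal; field; lra).
    assert (0 <= (r / s) ^ n) by (apply pow_le, Rdiv_le_0_compat; lra).
    pose proof (Cmod_ge_0 (c n)).
    apply Rle_trans with ((r / s) ^ n * (Cmod (c n) * s ^ n)).
    + rewrite (Rmult_comm (Cmod (c n))), <- Rmult_assoc, E.
      apply Rmult_le_compat_r; auto.
    + rewrite (Rmult_comm B); apply Rmult_le_compat_l; auto.
Qed.

(** Term by term n s^n is at most 1 + s + ... + s^(n-1) = (1 - s^n) / (1 - s), and this sharper
    inequality is what the induction proves. *)
Lemma n_pow_bound (s : R) (n : nat) : 0 <= s < 1 -> INR n * s ^ n <= 1 / (1 - s).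
Proof.
  intros Hs; apply (proj1 (Rle_div_r (INR n * s ^ n) 1 (1 - s) ltac:(lra))).
  enough (INR n * s ^ n * (1 - s) <= 1 - s ^ n)
    by (pose proof (pow_le s n (proj1 Hs)); lra).
  induction n as [|n IH]; [simpl; lra|].
  rewrite S_INR; simpl.
  assert (H0 : 0 <= s ^ n <= 1)
    by (split; [apply pow_le; lra | rewrite <- (pow1 n); apply pow_incr; lra]).
  set (p := s ^ n) in *; set (v := INR n * p) in *.
  replace ((INR n + 1) * (s * p) * (1 - s)) with (s * (v * (1 - s)) + s * p * (1 - s))
    by (unfold v; ring).
  assert (s * (v * (1 - s)) <= s * (1 - p)) by (apply Rmult_le_compat_l; lra).
  assert (s * p <= 1) by (rewrite <- (Rmult_1_r 1); apply Rmult_le_compat; lra).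
  assert (s * p * (1 - s) <= 1 * (1 - s)) by (apply Rmult_le_compat_r; lra).
  lra.
Qed.

(** The factor [r * r] on the left stands for an exponent n - 2 on the right, which natural
    subtraction would distort for n < 2. The induction step multiplies the remainder by w and adds n
    z^(n-1) (w - z)^2; at n = 0 the value of [pred] is harmless, being multiplied by [INR 0]. *)
Lemma pow_taylor_remainder (z w : C) (r : R) (n : nat) :
  Cmod z <= r -> Cmod w <= r ->
  Cmod (w ^ n - z ^ n - RtoC (INR n) * z ^ pred n * (w - z)) * (r * r)
    <= INR n * INR n * r ^ n * (Cmod (w - z) * Cmod (w - z)).
Proof.
  intros Hz Hw; pose proof (Cmod_ge_0 z); pose proof (Cmod_ge_0 w).
  pose proof (Cmod_ge_0 (w - z)) as Hd; set (d := Cmod (w - z)) in *.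
  assert (Hr : 0 <= r) by lra.
  induction n as [|n IH].
  - simpl; replace (1 - 1 - RtoC 0 * 1 * (w - z))%C with (RtoC 0) by ring.
    rewrite Cmod_0; lra.
  - simpl pred.
    replace (w ^ S n - z ^ S n - RtoC (INR (S n)) * z ^ n * (w - z))%C
      with (w * (w ^ n - z ^ n - RtoC (INR n) * z ^ pred n * (w - z))
            + RtoC (INR n) * z ^ pred n * ((w - z) * (w - z)))%C.
    2: { rewrite S_INR, RtoC_plus, !Cpow_S; destruct n as [|n]; [simpl; ring|].
         simpl pred; rewrite !Cpow_S; ring. }
    assert (Hn : Cmod (RtoC (INR n) * z ^ pred n * ((w - z) * (w - z))) * (r * r)
        <= INR n * r ^ S n * (d * d)).
    { rewrite !Cmod_mult, Cmod_pow, Cmod_R, Rabs_pos_eq by apply pos_INR; fold d.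
      destruct n as [|n]; [simpl; lra|].
      simpl pred.
      assert (Cmod z ^ n <= r ^ n) by (apply pow_incr; lra).
      replace (INR (S n) * Cmod z ^ n * (d * d) * (r * r))
        with (INR (S n) * (d * d) * (r * r) * Cmod z ^ n) by ring.
      replace (INR (S n) * r ^ S (S n) * (d * d))
        with (INR (S n) * (d * d) * (r * r) * r ^ n) by (simpl; ring).
      apply Rmult_le_compat_l; auto.
      pose proof (pos_INR (S n)); apply Rmult_le_pos; [apply Rmult_le_pos; nra | nra]. }
    eapply Rle_trans; [apply Rmult_le_compat_r; [nra | apply Cmod_triangle]|].
    rewrite Rmult_plus_distr_r, Cmod_mult.
    set (X := Cmod (w ^ n - z ^ n - RtoC (INR n) * z ^ pred n * (w - z))) in *.
    assert (HX : Cmod w * X * (r * r) <= r * (INR n * INR n * r ^ n * (d * d))).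
    { rewrite Rmult_assoc; apply Rmult_le_compat; auto.
      apply Rmult_le_pos; [apply Cmod_ge_0 | nra]. }
    rewrite S_INR; simpl in *.
    assert (0 <= r * r ^ n * (d * d))
      by (repeat apply Rmult_le_pos; auto; apply pow_le; auto).
    pose proof (pos_INR n); nra.
Qed.

(** In [pseries_cdiff] the four factors of r^n = (s^n)^4 are spent separately: two absorb n^2, one
    the coefficient, and the last remains as a geometric factor. With x = 1 - 8 t, Bernoulli's
    inequality (1 - t)^4 >= 1 - 4 t suffices. *)
Lemma fourth_root_room (x : R) : 0 <= x < 1 -> exists s, 0 < s < 1 /\ x < s ^ 4.
Proof.
  intros Hx; exists (1 - (1 - x) / 8); split; [lra|].
  set (t := (1 - x) / 8); assert (0 < t <= / 8) by (unfold t; lra).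
  replace x with (1 - 8 * t) by (unfold t; field).
  nra.
Qed.

(** With [D] the sum of the termwise derivatives, g(w) - g(z0) - D (w - z0) is at most Q |w - z0|^2
    on |w| <= r, because the second order remainders of the monomials are dominated by the summable
    n^2 r^n |c_n|. *)
Lemma pseries_cdiff (c : nat -> C) (g : C -> C) :
  subexponential c -> (forall z, Cmod z < 1 -> conv (fun k => z ^ k * c k)%C (g z)) -> cdiff_disc g.
Proof.
  intros Hc Hg z0 Hz0.
  destruct (fourth_root_room (Cmod z0)) as [s [Hs Hzs]]; [split; [apply Cmod_ge_0 | auto]|].
  destruct (Hc s Hs) as [B HB].
  set (r := s ^ 4) in *.
  assert (Hr : 0 < r) by (apply pow_lt; lra).
  assert (Hr1 : r < 1).
  { apply Rle_lt_trans with (s ^ 1); [|simpl; lra].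
    unfold r; simpl; assert (s * s <= 1) by nra; assert (0 <= s * s) by nra; nra. }
  assert (Hrn : forall n, r ^ n = (s ^ n) ^ 4)
    by (intros n; unfold r; rewrite <- !pow_mult; f_equal; lia).
  assert (HB0 : 0 <= B)
    by (pose proof (HB 0%nat) as H; pose proof (Cmod_ge_0 (c 0%nat)); simpl in H; lra).
  assert (Hsn : forall n, 0 < s ^ n <= 1).
  { intros n; split; [apply pow_lt; lra | rewrite <- (pow1 n); apply pow_incr; lra]. }
  set (q := 1 / (1 - s)).
  assert (Hq : 1 <= q) by (unfold q; apply Rle_div_r; lra).
  assert (Hnq : forall n, INR n * s ^ n <= q) by (intros n; apply n_pow_bound; lra).
  assert (Hqs : q * (1 - s) = 1) by (unfold q; field; lra).
  clearbody q.
  assert (Hn2 : forall n, INR n * INR n * r ^ n * Cmod (c n) <= q * q * B * s ^ n).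
  { intros n; rewrite Hrn.
    replace (INR n * INR n * (s ^ n) ^ 4 * Cmod (c n))
      with ((INR n * s ^ n) * (INR n * s ^ n) * (Cmod (c n) * s ^ n) * s ^ n) by ring.
    pose proof (pos_INR n); pose proof (Cmod_ge_0 (c n)); pose proof (Hsn n).
    apply Rmult_le_compat_r; [lra|].
    assert (0 <= INR n * s ^ n) by nra.
    apply Rmult_le_compat; auto; try nra.
    apply Rmult_le_compat; auto. }
  set (a := fun n => (RtoC (INR n) * z0 ^ pred n * c n)%C).
  assert (Ha : forall n, Cmod (a n) <= q * q * B / r * s ^ n).
  { intros n.
    apply (Rmult_le_reg_r r); [auto|].
    replace (q * q * B / r * s ^ n * r) with (q * q * B * s ^ n) by (field; lra).
    eapply Rle_trans; [|apply Hn2].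
    unfold a; rewrite !Cmod_mult, Cmod_pow, Cmod_R, Rabs_pos_eq by apply pos_INR.
    destruct n as [|n]; [simpl; lra|].
    simpl pred.
    assert (Cmod z0 ^ n <= r ^ n) by (apply pow_incr; split; [apply Cmod_ge_0 | lra]).
    pose proof (Cmod_ge_0 (c (S n))).
    assert (1 <= INR (S n)) by (rewrite S_INR; pose proof (pos_INR n); lra).
    assert (0 <= r ^ n) by (apply pow_le; lra).
    replace (INR (S n) * Cmod z0 ^ n * Cmod (c (S n)) * r)
      with (INR (S n) * (r * Cmod (c (S n))) * Cmod z0 ^ n) by ring.
    replace (INR (S n) * INR (S n) * r ^ S n * Cmod (c (S n)))
      with (INR (S n) * (r * Cmod (c (S n))) * r ^ n * INR (S n)) by (simpl; ring).
    assert (0 <= INR (S n) * (r * Cmod (c (S n)))) by (repeat apply Rmult_le_pos; lra).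
    assert (INR (S n) * (r * Cmod (c (S n))) * Cmod z0 ^ n
      <= INR (S n) * (r * Cmod (c (S n))) * r ^ n) by (apply Rmult_le_compat_l; auto).
    assert (0 <= INR (S n) * (r * Cmod (c (S n))) * r ^ n) by (apply Rmult_le_pos; lra).
    set (X := INR (S n) * (r * Cmod (c (S n))) * r ^ n) in *.
    assert (X * 1 <= X * INR (S n)) by (apply Rmult_le_compat_l; lra).
    lra. }
  destruct (geometric_conv a _ s ltac:(lra) Ha) as [D [HD _]].
  set (Q := q * q * B * q / (r * r)).
  assert (HQ0 : 0 <= Q) by (unfold Q; apply Rdiv_le_0_compat; [repeat apply Rmult_le_pos; lra | nra]).
  assert (HQ : forall w, Cmod w <= r ->
     Cmod (g w - g z0 - D * (w - z0)) <= Q * (Cmod (w - z0) * Cmod (w - z0))).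
  { intros w Hw; set (d := Cmod (w - z0)).
    set (b := fun n => ((w ^ n - z0 ^ n - RtoC (INR n) * z0 ^ pred n * (w - z0)) * c n)%C).
    assert (Hd : 0 <= d) by apply Cmod_ge_0.
    assert (Hb : forall n, Cmod (csum b n) <= Q * (d * d)).
    (* The factor [q * (1 - s ^ S n)] is the geometric sum 1 + s + ... + s^n, so each new term is
       accounted for exactly. *)
    { intros n; apply Rle_trans with (q * q * B / (r * r) * (d * d) * (q * (1 - s ^ S n))).
      - induction n as [|n IH].
        + rewrite csum_0; unfold b; simpl.
          replace ((RtoC 1 - RtoC 1 - RtoC 0 * RtoC 1 * (w - z0)) * c 0%nat)%C with (RtoC 0) by ring.
          rewrite Cmod_0, Rmult_1_r.
          apply Rmult_le_pos; [|apply Rmult_le_pos; lra].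
          apply Rmult_le_pos; [|nra].
          apply Rdiv_le_0_compat; [repeat apply Rmult_le_pos; lra | nra].
        + rewrite csum_S; eapply Rle_trans; [apply Cmod_triangle|].
          replace (q * q * B / (r * r) * (d * d) * (q * (1 - s ^ S (S n))))
            with (q * q * B / (r * r) * (d * d) * (q * (1 - s ^ S n))
                  + q * q * B * s ^ S n / (r * r) * (d * d))
            by (replace (q * (1 - s ^ S (S n))) with (q * (1 - s ^ S n) + q * (1 - s) * s ^ S n)
                  by (simpl; ring); rewrite Hqs; field; lra).
          apply Rplus_le_compat; [exact IH|].
          set (m := S n).
          unfold b; rewrite Cmod_mult.
          apply (Rmult_le_reg_r (r * r)); [nra|].
          replace (q * q * B * s ^ m / (r * r) * (d * d) * (r * r))
            with (q * q * B * s ^ m * (d * d)) by (field; lra).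
          pose proof (pow_taylor_remainder z0 w r m ltac:(lra) Hw) as H; fold d in H.
          pose proof (Cmod_ge_0 (c m)); specialize (Hn2 m).
          eapply Rle_trans with (INR m * INR m * r ^ m * (d * d) * Cmod (c m)).
          * match goal with |- ?x * ?y * ?t <= _ => replace (x * y * t) with (x * t * y) by ring end.
            apply Rmult_le_compat_r; auto.
          * replace (INR m * INR m * r ^ m * (d * d) * Cmod (c m))
              with (INR m * INR m * r ^ m * Cmod (c m) * (d * d)) by ring.
            apply Rmult_le_compat_r; [nra | exact Hn2].
      - unfold Q.
        replace (q * q * B * q / (r * r) * (d * d))
          with (q * q * B / (r * r) * (d * d) * (q * 1)) by (field; lra).
        apply Rmult_le_compat_l.
        + apply Rmult_le_pos; [|nra].
          apply Rdiv_le_0_compat; [repeat apply Rmult_le_pos; lra | nra].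
        + apply Rmult_le_compat_l; [lra|]; pose proof (Hsn (S n)); lra. }
    assert (Eb : forall n, csum b n = (csum (fun k => w ^ k * c k) n
        - csum (fun k => z0 ^ k * c k) n - csum a n * (w - z0))%C).
    { induction n as [|n IH]; [rewrite !csum_0|rewrite !csum_S, IH]; unfold b, a; ring. }
    apply le_epsilon; intros eps Heps.
    (* Two limits enter with weight 1 and the limit of the derivative series with weight d, so 3 + d
       covers them. *)
    assert (He3 : 0 < eps / (3 + d)) by (apply Rdiv_lt_0_compat; lra).
    destruct (Hg w ltac:(lra) _ He3) as [N1 H1].
    destruct (Hg z0 Hz0 _ He3) as [N2 H2].
    destruct (HD _ He3) as [N3 H3].
    set (n := max N1 (max N2 N3)).
    specialize (H1 n ltac:(lia)); specialize (H2 n ltac:(lia)); specialize (H3 n ltac:(lia)).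
    specialize (Hb n); rewrite Eb in Hb.
    set (x1 := csum (fun k => w ^ k * c k)%C n) in *.
    set (x2 := csum (fun k => z0 ^ k * c k)%C n) in *.
    set (x3 := csum a n) in *.
    replace (g w - g z0 - D * (w - z0))%C
      with ((x1 - x2 - x3 * (w - z0)) + - (x1 - g w) + (x2 - g z0) + (x3 - D) * (w - z0))%C by ring.
    eapply Rle_trans; [apply Cmod_triangle|].
    eapply Rle_trans; [apply Rplus_le_compat_r, Cmod_triangle|].
    eapply Rle_trans; [apply Rplus_le_compat_r, Rplus_le_compat_r, Cmod_triangle|].
    rewrite Cmod_opp, Cmod_mult; fold d.
    assert (eps / (3 + d) * (3 + d) = eps) by (field; lra).
    assert (Cmod (x3 - D) * d <= eps / (3 + d) * d) by (apply Rmult_le_compat_r; lra).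
    nra. }
  exists D; intros eps Heps.
  exists (Rmin (r - Cmod z0) (eps / (Q + 1))); split.
  - apply Rmin_glb_lt; [lra | apply Rdiv_lt_0_compat; lra].
  - intros w Hw; apply Rmin_Rgt in Hw as [Hw1 Hw2].
    assert (Hwr : Cmod w <= r).
    { pose proof (Cmod_minus_triangle w z0); lra. }
    eapply Rle_trans; [apply HQ, Hwr|].
    apply Rlt_div_r in Hw2; [|lra].
    pose proof (Cmod_ge_0 (w - z0)); nra.
Qed.

(** * Lebesgue constants *)

Lemma csum_geometric (x : C) (n : nat) :
  ((1 - x) * csum (fun j => x ^ j) n)%C = (1 - x ^ S n)%C.
Proof.
  induction n as [|n IH]; [rewrite csum_0; simpl; ring|].
  rewrite csum_S, Cmult_plus_distr_l, IH, !Cpow_S; ring.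
Qed.

(** Here sin t >= t - t^3 / 6, and t^2 <= 4 because pi <= 4. The slope 1/3 is enough for
    [sin_PI_lower] because pi >= 3. *)
Lemma sin_third_lower (t : R) : 0 <= t <= PI / 2 -> t / 3 <= sin t.
Proof.
  intros Ht; pose proof PI_4 as Hpi.
  destruct (sin_bound t 0) as [Hs _]; [lra | lra |].
  eapply Rle_trans; [|exact Hs].
  unfold sin_approx, sin_term; simpl.
  replace (1 * (t * 1 / 1) + -1 * 1 * (t * (t * (t * 1)) / (2 + 1 + 1 + 1 + 1)))
    with (t - t * t * t / 6) by field.
  assert (t * t <= 4) by nra.
  nra.
Qed.

Lemma Cmod_1_minus_cis (t : R) : Cmod (1 - cis (2 * t)) = 2 * Rabs (sin t).
Proof.
  unfold Cmod, cis; simpl.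
  rewrite cos_2a_sin, sin_2a.
  replace ((1 + - (1 - 2 * sin t * sin t)) * ((1 + - (1 - 2 * sin t * sin t)) * 1)
     + (0 + - (2 * sin t * cos t)) * ((0 + - (2 * sin t * cos t)) * 1))
    with ((2 * sin t)²).
  - rewrite sqrt_Rsqr_abs, Rabs_mult, (Rabs_pos_eq 2); lra.
  - pose proof (sin2_cos2 t) as H; unfold Rsqr in *.
    transitivity (4 * (sin t * sin t) * (sin t * sin t + cos t * cos t)); [rewrite H; ring | ring].
Qed.

Lemma sin_PI_lower (t : R) : 0 < t <= 1 / 2 -> t <= sin (PI * t).
Proof.
  intros Ht; pose proof PI2_3_2; pose proof PI_RGT_0.
  eapply Rle_trans; [|apply sin_third_lower; nra]; nra.
Qed.

(** The modulus is 2 sin(pi t), at least twice the smaller of t and 1 - t by symmetry; the sum on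
    the right replaces a maximum. *)
Lemma inv_Cmod_1_minus_cis (t : R) :
  0 < t < 1 -> 2 / Cmod (1 - cis (2 * - (PI * t))) <= / t + / (1 - t).
Proof.
  intros Ht; rewrite Cmod_1_minus_cis, sin_neg, Rabs_Ropp.
  assert (H1 : 0 < / t) by (apply Rinv_0_lt_compat; lra).
  assert (H2 : 0 < / (1 - t)) by (apply Rinv_0_lt_compat; lra).
  assert (K : forall m, 0 < m -> m <= sin (PI * t) ->
     2 / (2 * Rabs (sin (PI * t))) <= / m).
  { intros m Hm Hs; rewrite Rabs_pos_eq by lra.
    replace (2 / (2 * sin (PI * t))) with (/ sin (PI * t)) by (field; lra).
    apply Rinv_le_contravar; auto. }
  destruct (Rle_lt_dec t (1 / 2)) as [H|H].
  - pose proof (K t ltac:(lra) (sin_PI_lower t ltac:(lra))); lra.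
  - pose proof (K (1 - t)) as K1.
    rewrite <- (sin_PI_x (PI * t)) in K1.
    replace (PI - PI * t) with (PI * (1 - t)) in K1 by ring.
    specialize (K1 ltac:(lra) (sin_PI_lower (1 - t) ltac:(lra))).
    replace (sin (PI * (1 - t))) with (sin (PI * t)) in K1; [lra|].
    rewrite <- (sin_PI_x (PI * t)); f_equal; ring.
Qed.

(** An argument of the j-th of the M-th roots of unity, raised to the power k - n. The subtraction
    is real, so k < n is allowed. *)
Definition root_angle (M j k n : nat) : R := 2 * PI * (INR k - INR n) / INR M * INR j.

Lemma root_power (M j k n : nat) :
  cis (root_angle M j k n) = (cis (2 * PI * (INR k - INR n) / INR M) ^ j)%C.
Proof. rewrite cis_pow; unfold root_angle; f_equal; ring. Qed.

(** For k <> n the number k - n is not a multiple of M + 1, so this is a geometric sum whose ratio x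
    satisfies x <> 1 and x^(M+1) = 1. *)
Lemma roots_orthogonal (M k n : nat) :
  (k <= M)%nat -> (n <= M)%nat ->
  csum (fun j => cis (root_angle (S M) j k n)) M =
  if Nat.eq_dec k n then RtoC (INR (S M)) else RtoC 0.
Proof.
  intros Hk Hn.
  assert (HM : 0 < INR (S M)) by (apply lt_0_INR; lia).
  destruct (Nat.eq_dec k n) as [<-|Hkn].
  - assert (H : forall m, csum (fun j => cis (root_angle (S M) j k k)) m = RtoC (INR (S m))).
    { intros m; induction m as [|m IH].
      - rewrite csum_0; unfold root_angle; simpl; rewrite Rmult_0_r; apply cis_0.
      - rewrite csum_S, IH, (S_INR (S m)), RtoC_plus; f_equal.
        unfold root_angle; replace (2 * PI * (INR k - INR k) / INR (S M) * INR (S m)) with 0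
          by (field; lra); apply cis_0. }
    apply H.
  - set (t := PI * (INR k - INR n) / INR (S M)).
    set (x := cis (2 * t)).
    rewrite (csum_ext _ (fun j => x ^ j)%C)
      by (intros j _; rewrite root_power; unfold x, t; do 2 f_equal; field; lra).
    assert (Hx1 : (x ^ S M)%C = 1).
    { unfold x; rewrite cis_pow.
      replace (INR (S M) * (2 * t)) with (2 * INR k * PI + - (2 * INR n * PI))
        by (unfold t; field; lra).
      rewrite cis_plus, cis_opp, !cis_2PI; field. }
    pose proof (csum_geometric x M) as H; rewrite Hx1 in H.
    assert (Hx : (1 - x)%C <> 0).
    { apply Cmod_gt_0; unfold x; rewrite Cmod_1_minus_cis.
      assert (Hs : forall m, (0 < m <= M)%nat -> 0 < sin (PI * INR m / INR (S M))).
      { intros m Hm; pose proof PI_RGT_0.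
        assert (0 < INR m) by (apply lt_0_INR; lia).
        assert (INR m < INR (S M)) by (apply lt_INR; lia).
        apply sin_gt_0.
        - apply Rdiv_lt_0_compat; nra.
        - apply Rlt_div_l; nra. }
      destruct (Nat.lt_ge_cases n k) as [H'|H'].
      - specialize (Hs (k - n)%nat ltac:(lia)); rewrite minus_INR in Hs by lia.
        fold t in Hs; rewrite Rabs_pos_eq; lra.
      - specialize (Hs (n - k)%nat ltac:(lia)); rewrite minus_INR in Hs by lia.
        replace t with (- (PI * (INR n - INR k) / INR (S M))) by (unfold t; field; lra).
        rewrite sin_neg, Rabs_Ropp, Rabs_pos_eq; lra. }
    replace (csum (fun j => x ^ j)%C M)
      with ((1 - x) * csum (fun j => x ^ j) M / (1 - x))%C by (field; auto).
    rewrite H; field; auto.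
Qed.

(** The one-sided Dirichlet kernel with frequencies 0, ..., -N, sampled at the (M+1)-st roots of
    unity. *)
Definition dirichlet (M N j : nat) : C :=
  csum (fun n => cis (root_angle (S M) j 0 n)) N.

Lemma root_mult (M j k n : nat) :
  (cis (root_angle (S M) j k 0) * cis (root_angle (S M) j 0 n))%C
  = cis (root_angle (S M) j k n).
Proof.
  rewrite <- cis_plus; f_equal; unfold root_angle; change (INR 0) with 0.
  field; apply not_0_INR; lia.
Qed.

Lemma csum_delta (a : C) (k N : nat) :
  csum (fun n => if Nat.eq_dec k n then a else RtoC 0) N = if le_dec k N then a else RtoC 0.
Proof.
  induction N as [|N IH].
  - rewrite csum_0; destruct Nat.eq_dec, le_dec; auto; lia.
  - rewrite csum_S, IH; destruct Nat.eq_dec, (le_dec k N), (le_dec k (S N)); try lia; ring.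
Qed.

Lemma csum_switch (u : nat -> nat -> C) (m n : nat) :
  csum (fun i => csum (u i) n) m = csum (fun j => csum (fun i => u i j) m) n.
Proof. exact (sum_n_switch (G := C_Ring) u m n). Qed.

Lemma dirichlet_monomial (M N k : nat) :
  (k <= M)%nat -> (N <= M)%nat ->
  csum (fun j => cis (root_angle (S M) j k 0) * dirichlet M N j)%C M
  = if le_dec k N then RtoC (INR (S M)) else RtoC 0.
Proof.
  intros Hk HN.
  rewrite (csum_ext _ (fun j => csum (fun n => cis (root_angle (S M) j k n)) N)).
  - rewrite csum_switch.
    rewrite (csum_ext _ (fun n => if Nat.eq_dec k n then RtoC (INR (S M)) else RtoC 0)).
    + apply csum_delta.
    + intros n Hn; apply roots_orthogonal; lia.
  - intros j _; unfold dirichlet; rewrite <- csum_scal.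
    apply csum_ext; intros n _; apply root_mult.
Qed.

(* Convolution with the Dirichlet kernel over the [(M+1)]-st roots of unity is exact
   on polynomials of degree at most [M], so no integral is needed. *)
Lemma dirichlet_polynomial (M N K : nat) (c : nat -> C) (z : C) :
  (K <= M)%nat -> (N <= K)%nat ->
  csum (fun j => csum (fun k => (z * cis (root_angle (S M) j 1 0)) ^ k * c k) K
                 * dirichlet M N j)%C M
  = (RtoC (INR (S M)) * csum (fun k => z ^ k * c k) N)%C.
Proof.
  intros HK HN.
  transitivity (csum (fun k => csum (fun j =>
     (z ^ k * c k) * (cis (root_angle (S M) j k 0) * dirichlet M N j)) M)%C K).
  - rewrite csum_switch; apply csum_ext; intros j _.
    rewrite Cmult_comm, <- csum_scal; apply csum_ext; intros k _.
    rewrite Cpow_mult_l, cis_pow.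
    replace (INR k * root_angle (S M) j 1 0) with (root_angle (S M) j k 0)
      by (unfold root_angle; change (INR 0) with 0; change (INR 1) with 1; field; apply not_0_INR; lia).
    ring.
  - transitivity (csum (fun k => if le_dec k N then
       (RtoC (INR (S M)) * (z ^ k * c k))%C else RtoC 0) K).
    + apply csum_ext; intros k Hk.
      rewrite csum_scal, dirichlet_monomial by lia.
      destruct le_dec; ring.
    + rewrite <- csum_scal; revert HN; clear; induction K as [|K IH]; intros HN.
      * replace N with 0%nat by lia; rewrite !csum_0; reflexivity.
      * destruct (Nat.eq_dec N (S K)) as [->|E].
        -- apply csum_ext; intros k Hk; destruct le_dec; [reflexivity | lia].
        -- rewrite csum_S, IH by lia; destruct le_dec; [lia | ring].
Qed.

Lemma Cmod_dirichlet_trivial (M N j : nat) : Cmod (dirichlet M N j) <= INR (S N).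
Proof.
  eapply Rle_trans; [apply csum_Cmod_le|].
  induction N as [|N IH]; [simpl; rewrite Cmod_cis; lra|].
  rewrite S_INR; simpl sum_f_R0; rewrite Cmod_cis; lra.
Qed.

Lemma Cmod_dirichlet_decay (M N j : nat) :
  (0 < j <= M)%nat ->
  Cmod (dirichlet M N j) <= INR (S M) / INR j + INR (S M) / INR (S M - j).
Proof.
  intros Hj.
  assert (HM : 0 < INR (S M)) by (apply lt_0_INR; lia).
  assert (Hj0 : 0 < INR j) by (apply lt_0_INR; lia).
  assert (HjM : INR j < INR (S M)) by (apply lt_INR; lia).
  set (t := INR j / INR (S M)).
  assert (Ht : 0 < t < 1) by (split; [apply Rdiv_lt_0_compat | apply Rlt_div_l]; lra).
  set (y := cis (2 * - (PI * t))).
  assert (E : dirichlet M N j = csum (fun n => y ^ n)%C N).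
  { apply csum_ext; intros n _; unfold y; rewrite cis_pow; f_equal.
    unfold root_angle, t; change (INR 0) with 0; field; lra. }
  rewrite E.
  assert (Hy : 0 < Cmod (1 - y)).
  { unfold y; rewrite Cmod_1_minus_cis, sin_neg, Rabs_Ropp.
    assert (0 < sin (PI * t)) by (pose proof PI_RGT_0; apply sin_gt_0; nra).
    rewrite Rabs_pos_eq; lra. }
  eapply Rle_trans with (2 / Cmod (1 - y)).
  - apply Rle_div_r; [auto|].
    rewrite Rmult_comm, <- Cmod_mult, csum_geometric.
    eapply Rle_trans; [apply Cmod_triangle|].
    rewrite Cmod_opp, Cmod_pow, Cmod_1; unfold y; rewrite Cmod_cis, pow1; lra.
  - eapply Rle_trans; [apply inv_Cmod_1_minus_cis, Ht|].
    rewrite minus_INR by lia.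
    apply Req_le; unfold t; field; lra.
Qed.

(** The trivial bound before the cut-off [Q], the decay M / j from there on. For M = (N + 1) Q the
    two agree at j = Q, and Q > 0 keeps j = 0 away from the quotient. *)
Definition dirichlet_majorant (M Q N j : nat) : R :=
  if lt_dec j Q then INR (S N) else INR M / INR j.

Lemma dirichlet_majorant_nonneg (M Q N j : nat) :
  (0 < Q)%nat -> 0 <= dirichlet_majorant M Q N j.
Proof.
  intros HQ; unfold dirichlet_majorant; destruct lt_dec; [apply pos_INR|].
  apply Rdiv_le_0_compat; [apply pos_INR | apply lt_0_INR; lia].
Qed.

Lemma Cmod_dirichlet_le (M Q N j : nat) :
  (0 < Q)%nat -> (j <= M)%nat ->
  Cmod (dirichlet M N j)
    <= dirichlet_majorant (S M) Q N j + dirichlet_majorant (S M) Q N (S M - j).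
Proof.
  intros HQ Hj.
  pose proof (dirichlet_majorant_nonneg (S M) Q N j HQ) as H1.
  pose proof (dirichlet_majorant_nonneg (S M) Q N (S M - j) HQ) as H2.
  pose proof (Cmod_dirichlet_trivial M N j) as H3.
  unfold dirichlet_majorant in *.
  destruct (lt_dec j Q); [lra|].
  destruct (lt_dec (S M - j) Q); [lra|].
  apply Cmod_dirichlet_decay; lia.
Qed.

Lemma inv_succ_le_ln (m : nat) : (0 < m)%nat -> / INR (S m) <= ln (INR (S m)) - ln (INR m).
Proof.
  intros Hm.
  assert (H0 : 0 < INR m) by (apply lt_0_INR; lia).
  assert (H1 : 0 < INR (S m)) by (apply lt_0_INR; lia).
  rewrite <- ln_div by lra.
  replace (INR (S m) / INR m) with (/ (INR m / INR (S m))) by (field; lra).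
  rewrite ln_Rinv by (apply Rdiv_lt_0_compat; lra).
  assert (H2 : 0 < INR m / INR (S m)) by (apply Rdiv_lt_0_compat; lra).
  pose proof (exp_ineq1_le (ln (INR m / INR (S m)))) as H.
  rewrite exp_ln in H by auto.
  assert (INR m / INR (S m) = 1 - / INR (S m)) by (rewrite S_INR in *; field; lra).
  lra.
Qed.

(** The flat part sums to Q (N + 1) = M and the term j = Q adds at most another M, which explains
    the constant 2. The remaining harmonic sum is compared with the logarithm. *)
Lemma sum_dirichlet_majorant (Q N m : nat) :
  (0 < Q)%nat ->
  let M := (S N * Q)%nat in
  sum_f_R0 (dirichlet_majorant M Q N) m <=
  if lt_dec m Q then INR (S m) * INR (S N) else INR M * (2 + (ln (INR m) - ln (INR Q))).
Proof.
  intros HQ M.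
  assert (HM : INR M = INR (S N) * INR Q) by apply mult_INR.
  assert (HQ1 : 1 <= INR Q) by (apply (le_INR 1); lia).
  assert (HN : 1 <= INR (S N)) by (apply (le_INR 1); lia).
  induction m as [|m IH].
  - simpl sum_f_R0; unfold dirichlet_majorant.
    destruct (lt_dec 0 Q); [simpl INR at 2; lra | lia].
  - simpl sum_f_R0; unfold dirichlet_majorant at 2.
    destruct (lt_dec (S m) Q) as [H|H].
    + destruct (lt_dec m Q); [|lia].
      rewrite (S_INR (S m)); lra.
    + destruct (lt_dec m Q) as [H'|H'].
      * assert (E : S m = Q) by lia.
        rewrite E in *.
        replace (INR Q * INR (S N)) with (INR M) in IH by lra.
        assert (INR M / INR Q <= INR M)
          by (apply (proj2 (Rle_div_l (INR M) (INR M) (INR Q) ltac:(lra))); pose proof (pos_INR M); nra).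
        lra.
      * pose proof (inv_succ_le_ln m ltac:(lia)) as Hln.
        assert (INR M / INR (S m) <= INR M * (ln (INR (S m)) - ln (INR m)))
          by (apply Rmult_le_compat_l; [apply pos_INR | exact Hln]).
        lra.
Qed.

Lemma sum_f_R0_reflect (f : nat -> R) (m : nat) :
  sum_f_R0 (fun j => f (m - j)%nat) m = sum_f_R0 f m.
Proof.
  induction m as [|m IH]; [reflexivity|].
  rewrite decomp_sum by lia; simpl pred.
  rewrite (sum_eq _ (fun j => f (m - j)%nat)) by (intros; f_equal; lia).
  rewrite IH; simpl; ring.
Qed.

Lemma sum_Cmod_dirichlet (Q N M : nat) :
  (0 < Q)%nat -> S M = (S N * Q)%nat ->
  sum_f_R0 (fun j => Cmod (dirichlet M N j)) M <= INR (S M) * (4 + 2 * ln (INR (S N))).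
Proof.
  intros HQ HM.
  set (b := dirichlet_majorant (S M) Q N).
  (* Adding the index M + 1 makes the range symmetric under j -> M + 1 - j, so both majorants have
     the same sum 2 + ln (N + 1), in units of M + 1. *)
  apply Rle_trans with (sum_f_R0 (fun j => b j + b (S M - j)%nat) (S M)).
  - apply Rle_trans with (sum_f_R0 (fun j => b j + b (S M - j)%nat) M).
    + apply sum_Rle; intros j Hj; apply Cmod_dirichlet_le; auto.
    + pose proof (dirichlet_majorant_nonneg (S M) Q N (S M) HQ) as H1.
      pose proof (dirichlet_majorant_nonneg (S M) Q N (S M - S M) HQ) as H2.
      rewrite tech5; fold b in H1, H2; lra.
  - rewrite sum_plus, (sum_f_R0_reflect b (S M)).
    pose proof (sum_dirichlet_majorant Q N (S M) HQ) as H; cbv zeta in H.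
    rewrite <- HM in H; fold b in H.
    assert (HNQ : (S M >= Q)%nat) by (rewrite HM; nia).
    destruct (lt_dec (S M) Q); [lia|].
    assert (El : ln (INR (S M)) = ln (INR (S N)) + ln (INR Q)).
    { rewrite HM, mult_INR; apply ln_mult; apply lt_0_INR; lia. }
    rewrite El in H; lra.
Qed.

Lemma partial_sum_polynomial_bound (c : nat -> C) (z : C) (N K : nat) (m : R) :
  (N <= K)%nat ->
  (forall w, Cmod w = Cmod z -> Cmod (csum (fun k => w ^ k * c k)%C K) <= m) ->
  Cmod (csum (fun k => z ^ k * c k)%C N) <= (4 + 2 * ln (INR (S N))) * m.
Proof.
  intros HNK Hm.
  (* The number M + 1 of roots must be a multiple of N + 1 for the majorant and exceed K for
     exactness; the cut-off is Q = K + 1. *)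
  set (M := (S N * S K - 1)%nat).
  assert (HM : S M = (S N * S K)%nat) by (unfold M; nia).
  assert (HKM : (K <= M)%nat) by nia.
  assert (Hm0 : 0 <= m) by (eapply Rle_trans; [apply Cmod_ge_0 | apply (Hm z eq_refl)]).
  pose proof (dirichlet_polynomial M N K c z HKM HNK) as E.
  assert (HMp : 0 < INR (S M)) by (apply lt_0_INR; lia).
  apply (Rmult_le_reg_l (INR (S M))); [auto|].
  replace (INR (S M)) with (Cmod (RtoC (INR (S M)))) at 1
    by (rewrite Cmod_R, Rabs_pos_eq; lra).
  rewrite <- Cmod_mult, <- E.
  eapply Rle_trans; [apply csum_Cmod_le|].
  eapply Rle_trans with (sum_f_R0 (fun j => Cmod (dirichlet M N j) * m) M).
  - apply sum_Rle; intros j _; rewrite Cmod_mult, Rmult_comm.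
    apply Rmult_le_compat_l; [apply Cmod_ge_0|].
    apply Hm; rewrite Cmod_mult, Cmod_cis; ring.
  - rewrite <- scal_sum, <- Rmult_assoc, (Rmult_comm m).
    apply Rmult_le_compat_r; [auto|].
    apply (sum_Cmod_dirichlet (S K)); auto; lia.
Qed.

(** The discrete kernel is exact on polynomials only, so h is replaced by a long Taylor polynomial,
    which is uniformly close to it on the circle |w| = |z| by the geometric majorant. The closeness
    [eta] is eps divided by the logarithmic factor. *)
Lemma partial_sum_bound (c : nat -> C) (h : C -> C) (z : C) (N : nat) (m : R) :
  subexponential c -> (forall w, Cmod w < 1 -> conv (fun k => w ^ k * c k)%C (h w)) ->
  Cmod z < 1 -> (forall w, Cmod w = Cmod z -> Cmod (h w) <= m) ->
  Cmod (csum (fun k => z ^ k * c k)%C N) <= (4 + 2 * ln (INR (S N))) * m.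
Proof.
  intros Hc Hh Hz Hm.
  assert (HL : 0 < 4 + 2 * ln (INR (S N))).
  { assert (0 <= ln (INR (S N))); [|lra].
    rewrite <- ln_1; apply ln_le; [lra | apply (le_INR 1); lia]. }
  apply le_epsilon; intros eps Heps.
  destruct (subexponential_conv c (Cmod z) Hc) as [B [x [Hx HB]]]; [split; [apply Cmod_ge_0 | auto]|].
  assert (HB0 : 0 <= B).
  { pose proof (HB z ltac:(lra) 0%nat) as H.
    pose proof (Cmod_ge_0 (z ^ 0 * c 0%nat)); simpl pow in H; lra. }
  set (eta := eps / (4 + 2 * ln (INR (S N)))).
  assert (Heta : 0 < eta) by (apply Rdiv_lt_0_compat; lra).
  assert (HBx : 0 < B / (1 - x) + 1)
    by (pose proof (Rdiv_le_0_compat B (1 - x) HB0 ltac:(lra)); lra).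
  destruct (pow_small x (eta / (B / (1 - x) + 1)) Hx) as [K0 HK0];
    [apply Rdiv_lt_0_compat; lra|].
  set (K := max N K0).
  eapply Rle_trans; [apply (partial_sum_polynomial_bound c z N K (m + eta)); [lia|]|].
  - intros w Hw.
    destruct (geometric_conv (fun k => w ^ k * c k)%C B x Hx) as [l [Hl Hl']];
      [intros i; apply HB; lra|].
    assert (El : Cmod (l - h w) <= 0).
    { apply le_epsilon; intros e0 He0; rewrite Rplus_0_l.
      destruct (Hh w ltac:(lra) e0 He0) as [n0 Hn0].
      apply (conv_limit_bound _ l (h w) e0 n0 Hl).
      intros n Hn; left; auto. }
    specialize (Hl' K).
    replace (csum (fun k => w ^ k * c k)%C K)
      with ((csum (fun k => w ^ k * c k)%C K - l) + (l - h w) + h w)%C by ring.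
    eapply Rle_trans; [apply Cmod_triangle|].
    eapply Rle_trans; [apply Rplus_le_compat_r, Cmod_triangle|].
    specialize (Hm w Hw).
    specialize (HK0 (S K) ltac:(unfold K; lia)).
    apply Rlt_div_r in HK0; [|lra].
    pose proof (pow_le x (S K) (proj1 Hx)); nra.
  - apply Req_le; unfold eta; field; lra.
Qed.

(** * Moments of the weight *)

Lemma is_RInt_01 (f : R -> R) :
  (forall r, 0 <= r <= 1 -> continuous f r) -> is_RInt f 0 1 (RInt f 0 1).
Proof.
  intros Hf; apply (RInt_correct (V := R_CompleteNormedModule)), ex_RInt_continuous.
  intros r; rewrite Rmin_left, Rmax_right by lra; apply Hf.
Qed.

Lemma continuous_Rmult (f g : R -> R) (x : R) :
  continuous f x -> continuous g x -> continuous (fun t => f t * g t) x.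
Proof. intros Hf Hg; exact (continuous_mult (K := R_AbsRing) f g x Hf Hg). Qed.

Lemma continuous_Rpow (n : nat) (x : R) : continuous (fun t => t ^ n) x.
Proof. apply (ex_derive_continuous (V := R_NormedModule)); auto_derive; auto. Qed.

Lemma RInt_pos_01 (f : R -> R) :
  (forall r, 0 <= r <= 1 -> continuous f r) -> (forall r, 0 < r < 1 -> 0 < f r) ->
  0 < RInt f 0 1.
Proof. intros Hc Hp; apply RInt_gt_0; auto; lra. Qed.

(* Chebyshev's association inequality.  If the mean [m] of [p] is the value
   [p t0], then [(r^2 - t0^2) (p r - m) >= 0], and integrating this is enough. *)
Lemma chebyshev_ratio (W p : R -> R) :
  (forall r, 0 <= r <= 1 -> continuous W r) ->
  (forall r, 0 < r < 1 -> 0 < W r) ->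
  (forall r, continuous p r) ->
  (forall r s, 0 <= r -> r <= s -> s <= 1 -> p r <= p s) ->
  RInt (fun r => W r * p r) 0 1 / RInt W 0 1 <=
  RInt (fun r => r ^ 2 * W r * p r) 0 1 / RInt (fun r => r ^ 2 * W r) 0 1.
Proof.
  intros HW HWp Hp Hmono.
  assert (C1 : forall r, 0 <= r <= 1 -> continuous (fun r => W r * p r) r)
    by (intros; apply continuous_Rmult; auto).
  assert (C2 : forall r, 0 <= r <= 1 -> continuous (fun r => r ^ 2 * W r) r)
    by (intros; apply continuous_Rmult; auto; apply continuous_Rpow).
  assert (C3 : forall r, 0 <= r <= 1 -> continuous (fun r => r ^ 2 * W r * p r) r)
    by (intros; apply continuous_Rmult; auto).
  pose proof (is_RInt_01 _ HW) as I0; pose proof (is_RInt_01 _ C1) as I1.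
  pose proof (is_RInt_01 _ C2) as I2; pose proof (is_RInt_01 _ C3) as I3.
  pose proof (RInt_pos_01 W HW HWp) as P0.
  assert (P2 : 0 < RInt (fun r => r ^ 2 * W r) 0 1).
  { apply RInt_pos_01; auto; intros r Hr; apply Rmult_lt_0_compat; [nra | auto]. }
  set (A := RInt W 0 1) in *; set (B := RInt (fun r => W r * p r) 0 1) in *.
  set (A2 := RInt (fun r => r ^ 2 * W r) 0 1) in *.
  set (B2 := RInt (fun r => r ^ 2 * W r * p r) 0 1) in *.
  set (m := B / A).
  assert (Hm1 : p 0 * A <= B).
  { apply (is_RInt_le (fun r => p 0 * W r) (fun r => W r * p r) 0 1); auto; [lra| |].
    - apply (is_RInt_scal (V := R_NormedModule) W 0 1 (p 0) A I0).
    - intros r Hr; rewrite (Rmult_comm (W r)); apply Rmult_le_compat_r;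
        [apply Rlt_le, HWp; lra | apply Hmono; lra]. }
  assert (Hm2 : B <= p 1 * A).
  { apply (is_RInt_le (fun r => W r * p r) (fun r => p 1 * W r) 0 1); auto; [lra| |].
    - apply (is_RInt_scal (V := R_NormedModule) W 0 1 (p 1) A I0).
    - intros r Hr; rewrite (Rmult_comm (W r)); apply Rmult_le_compat_r;
        [apply Rlt_le, HWp; lra | apply Hmono; lra]. }
  assert (HmA : m * A = B) by (unfold m; field; lra).
  assert (H01 : p 0 <= p 1) by (apply Hmono; lra).
  destruct (IVT_gen p 0 1 m) as [t0 [Ht0 Hpt0]].
  - intros r; apply continuity_pt_filterlim, Hp.
  - rewrite Rmin_left, Rmax_right by lra; split; nra.
  - rewrite Rmin_left, Rmax_right in Ht0 by lra.
    assert (I : is_RInt (fun r => (r ^ 2 * W r * p r - m * (r ^ 2 * W r))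
                   - t0 ^ 2 * (W r * p r - m * W r)) 0 1
                 ((B2 - m * A2) - t0 ^ 2 * (B - m * A))).
    { apply (is_RInt_minus (V := R_NormedModule)).
      - apply (is_RInt_minus (V := R_NormedModule)); [exact I3|].
        apply (is_RInt_scal (V := R_NormedModule)); exact I2.
      - apply (is_RInt_scal (V := R_NormedModule)).
        apply (is_RInt_minus (V := R_NormedModule)); [exact I1|].
        apply (is_RInt_scal (V := R_NormedModule)); exact I0. }
    assert (Z : is_RInt (fun _ => 0) 0 1 ((1 - 0) * 0))
      by exact (is_RInt_const (V := R_NormedModule) 0 1 0).
    rewrite Rmult_0_r in Z.
    pose proof (is_RInt_le _ _ 0 1 _ _ Rle_0_1 Z I) as H.
    apply (proj1 (Rle_div_r m B2 A2 P2)).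
    replace (B - m * A) with 0 in H by lra.
    enough (0 <= B2 - m * A2 - t0 ^ 2 * 0) by lra.
    apply H; intros r Hr.
    replace (r ^ 2 * W r * p r - m * (r ^ 2 * W r) - t0 ^ 2 * (W r * p r - m * W r))
      with (W r * ((r ^ 2 - t0 ^ 2) * (p r - m))) by ring.
    apply Rmult_le_pos; [apply Rlt_le, HWp, Hr|].
    destruct (Rle_lt_dec r t0) as [K|K].
    + pose proof (Hmono r t0 ltac:(lra) K ltac:(lra)) as Hr'.
      rewrite <- (Rmult_opp_opp (r ^ 2 - t0 ^ 2)); apply Rmult_le_pos; [nra | lra].
    + pose proof (Hmono t0 r ltac:(lra) ltac:(lra) ltac:(lra)).
      apply Rmult_le_pos; [nra | lra].
Qed.

(** * Averages against the moment densities *)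

Definition mweight (V : R -> R) (n : nat) (r : R) : R := r ^ (2 * n + 1) * V r.

(** For a real symbol with profile [p] this is gamma_n. *)
Definition mean (V : R -> R) (p : R -> R) (n : nat) : R :=
  RInt (fun r => mweight V n r * p r) 0 1 / RInt (mweight V n) 0 1.

(** Continuity is two-sided even at the end points. [profile01 v] has it because v is also defined
    at negative reals of the disc, and because the profile is 0 from 1 on. *)
Definition positive_profile (V : R -> R) : Prop :=
  (forall r, 0 <= r <= 1 -> continuous V r) /\ (forall r, 0 < r < 1 -> 0 < V r).

Lemma mweight_cont (V : R -> R) (n : nat) (r : R) :
  positive_profile V -> 0 <= r <= 1 -> continuous (mweight V n) r.
Proof. intros [HV _] Hr; apply continuous_Rmult; [apply continuous_Rpow | auto]. Qed.

Lemma mweight_pos (V : R -> R) (n : nat) (r : R) :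
  positive_profile V -> 0 < r < 1 -> 0 < mweight V n r.
Proof. intros [_ HV] Hr; apply Rmult_lt_0_compat; [apply pow_lt; lra | auto]. Qed.

Lemma mweight_mass_pos (V : R -> R) (n : nat) :
  positive_profile V -> 0 < RInt (mweight V n) 0 1.
Proof.
  intros HV; apply RInt_pos_01; intros; [apply mweight_cont | apply mweight_pos]; auto.
Qed.

(** Consecutive densities differ by the increasing factor r^2, the one built into
    [chebyshev_ratio]. *)
Lemma mean_nondecreasing (V p : R -> R) (n : nat) :
  positive_profile V -> (forall r, continuous p r) ->
  (forall r s, 0 <= r -> r <= s -> s <= 1 -> p r <= p s) ->
  mean V p n <= mean V p (S n).
Proof.
  intros HV Hp Hmono; unfold mean.
  eapply Rle_trans; [apply (chebyshev_ratio (mweight V n) p); auto|].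
  - intros; apply mweight_cont; auto.
  - intros; apply mweight_pos; auto.
  - assert (E : forall r, r ^ 2 * mweight V n r = mweight V (S n) r).
    { intros r; unfold mweight; rewrite <- Rmult_assoc, <- pow_add; do 2 f_equal; lia. }
    rewrite (RInt_ext (fun r => r ^ 2 * mweight V n r) (mweight V (S n)))
      by (intros r _; apply E).
    rewrite (RInt_ext (fun r => r ^ 2 * mweight V n r * p r) (fun r => mweight V (S n) r * p r))
      by (intros r _; rewrite E; reflexivity).
    apply Rle_refl.
Qed.

Lemma mean_lin (V p q : R -> R) (a b : R) (n : nat) :
  positive_profile V -> (forall r, continuous p r) -> (forall r, continuous q r) ->
  mean V (fun r => a * p r + b * q r) n = a * mean V p n + b * mean V q n.
Proof.
  intros HV Hp Hq; unfold mean.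
  pose proof (mweight_mass_pos V n HV).
  assert (H1 : is_RInt (fun r => mweight V n r * p r) 0 1 (RInt (fun r => mweight V n r * p r) 0 1))
    by (apply is_RInt_01; intros; apply continuous_Rmult; auto; apply mweight_cont; auto).
  assert (H2 : is_RInt (fun r => mweight V n r * q r) 0 1 (RInt (fun r => mweight V n r * q r) 0 1))
    by (apply is_RInt_01; intros; apply continuous_Rmult; auto; apply mweight_cont; auto).
  rewrite (is_RInt_unique _ 0 1 (a * RInt (fun r => mweight V n r * p r) 0 1
    + b * RInt (fun r => mweight V n r * q r) 0 1)).
  - field; lra.
  - eapply is_RInt_ext; [|apply (is_RInt_plus (V := R_NormedModule));
      apply (is_RInt_scal (V := R_NormedModule)); [exact H1 | exact H2]].
    intros r _; unfold plus, scal; simpl; unfold mult; simpl; ring.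
Qed.

Definition lipschitz01 (L : R) (p : R -> R) : Prop :=
  forall r s, 0 <= r <= 1 -> 0 <= s <= 1 -> Rabs (p s - p r) <= L * Rabs (s - r).

Definition rho (V : R -> R) : nat -> R := mean V (fun r => r).

(* [L r + p] and [L r - p] are both nondecreasing. *)
Lemma mean_increment (V p : R -> R) (L : R) (n : nat) :
  positive_profile V -> (forall r, continuous p r) -> lipschitz01 L p ->
  Rabs (mean V p (S n) - mean V p n) <= L * (rho V (S n) - rho V n).
Proof.
  intros HV Hp HL.
  assert (Hid : forall r : R, continuous (fun r : R => r) r) by (intros; apply continuous_id).
  assert (H : forall b, b = 1 \/ b = -1 ->
     mean V (fun r => L * r + b * p r) n <= mean V (fun r => L * r + b * p r) (S n)).
  { intros b Hb; apply mean_nondecreasing; auto.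
    - intros r; apply (continuous_plus (V := R_NormedModule));
        apply continuous_Rmult; auto; apply continuous_const.
    - intros r s Hr Hrs Hs; specialize (HL r s ltac:(lra) ltac:(lra)).
      rewrite (Rabs_pos_eq (s - r)) in HL by lra.
      pose proof (Rle_abs (p s - p r)); pose proof (Rle_abs (- (p s - p r))) as K.
      rewrite Rabs_Ropp in K; destruct Hb as [-> | ->]; lra. }
  pose proof (H 1 (or_introl eq_refl)) as H1.
  pose proof (H (-1) (or_intror eq_refl)) as H2.
  rewrite !(mean_lin V (fun r => r) p) in H1, H2 by auto.
  unfold rho; apply Rabs_le; lra.
Qed.

Lemma one_minus_rho (V : R -> R) (n : nat) :
  positive_profile V ->
  1 - rho V n = RInt (fun r => mweight V n r * (1 - r)) 0 1 / RInt (mweight V n) 0 1.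
Proof.
  intros HV; change (RInt (fun r => mweight V n r * (1 - r)) 0 1 / RInt (mweight V n) 0 1)
    with (mean V (fun r => 1 - r) n).
  assert (E : mean V (fun r => 1 - r) n = mean V (fun r => 1 * (fun _ => 1) r + -1 * r) n).
  { unfold mean; apply Rmult_eq_compat_r, RInt_ext; intros r _.
    change (mweight V n r * (1 - r) = mweight V n r * (1 * 1 + -1 * r)); ring. }
  rewrite E, (mean_lin V (fun _ => 1) (fun r => r)); auto;
    [|intros; apply continuous_const | intros; apply continuous_id].
  unfold rho.
  replace (mean V (fun _ => 1) n) with 1; [ring|].
  unfold mean; rewrite (RInt_ext (fun r => mweight V n r * 1) (mweight V n))
    by (intros; apply Rmult_1_r).
  field; apply Rgt_not_eq, mweight_mass_pos; auto.
Qed.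

Lemma one_minus_rho_nonneg (V : R -> R) (n : nat) : positive_profile V -> 0 <= 1 - rho V n.
Proof.
  intros HV; rewrite one_minus_rho by auto.
  apply Rdiv_le_0_compat; [|apply mweight_mass_pos; auto].
  apply Rlt_le, RInt_pos_01.
  - intros r Hr; apply continuous_Rmult; [apply mweight_cont; auto|].
    apply (continuous_minus (V := R_NormedModule)); [apply continuous_const | apply continuous_id].
  - intros r Hr; apply Rmult_lt_0_compat; [apply mweight_pos; auto | lra].
Qed.

Lemma rho_nondecreasing (V : R -> R) (n : nat) : positive_profile V -> rho V n <= rho V (S n).
Proof.
  intros HV.
  exact (mean_nondecreasing V (fun r => r) n HV (fun r => continuous_id r) (fun _ _ _ H _ => H)).
Qed.

(** The inequality e^x >= 1 + x is used twice: r^(-s) >= 1 - s ln r, and - ln r >= 1 - r. *)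
Lemma Rpower_moment_lower (r s : R) (n : nat) :
  0 < r < 1 -> 0 <= s -> s * (r ^ n * (1 - r)) <= Rpower r (INR n - s).
Proof.
  intros Hr Hs.
  unfold Rminus at 2; rewrite Rpower_plus, Rpower_pow by lra.
  assert (H1 : s * (1 - r) <= Rpower r (- s)).
  { unfold Rpower.
    pose proof (exp_ineq1_le (- s * ln r)) as H.
    pose proof (exp_ineq1_le (ln r)) as H'; rewrite exp_ln in H' by lra.
    nra. }
  pose proof (pow_lt r n (proj1 Hr)); nra.
Qed.

(** The integrands can be compared only on intervals [a, b] inside (0, 1). The left one is bounded
    on [0, 1], so its two end pieces are negligible. *)
Lemma improper_moment_lower (v V : R -> R) (n : nat) (s I : R) :
  positive_profile V -> (forall r, 0 < r < 1 -> V r = v r) -> 0 <= s ->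
  is_RInt_gen (fun r => Rpower r (INR n - s) * v r) (at_right 0) (at_left 1) I ->
  s * RInt (fun r => r ^ n * V r * (1 - r)) 0 1 <= I.
Proof.
  intros HV HvV Hs HI.
  set (g := fun r => s * (r ^ n * V r * (1 - r))).
  assert (Hc0 : forall r, 0 <= r <= 1 -> continuous (fun r => r ^ n * V r * (1 - r)) r).
  { intros r Hr; apply continuous_Rmult; [apply continuous_Rmult; [apply continuous_Rpow | apply HV, Hr]|].
    apply (continuous_minus (V := R_NormedModule)); [apply continuous_const | apply continuous_id]. }
  assert (Hc : forall r, 0 <= r <= 1 -> continuous g r)
    by (intros r Hr; apply continuous_Rmult; [apply continuous_const | apply Hc0, Hr]).
  set (G := s * RInt (fun r => r ^ n * V r * (1 - r)) 0 1).
  assert (HG : is_RInt g 0 1 G)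
    by (apply (is_RInt_scal (V := R_NormedModule)), is_RInt_01, Hc0).
  destruct (continuity_ab_maj g 0 1 Rle_0_1) as [x [Hx _]];
    [intros c Hc'; apply continuity_pt_filterlim, Hc, Hc'|].
  set (M := Rmax 0 (g x)).
  assert (HM : forall r, 0 <= r <= 1 -> g r <= M)
    by (intros r Hr; eapply Rle_trans; [apply Hx, Hr | apply Rmax_r]).
  assert (HM0 : 0 <= M) by apply Rmax_l.
  apply le_epsilon; intros eps Heps.
  (* Each end piece loses at most eta M <= eps / 4; the other eps / 2 is spent on approximating [I].
     The bound 1/2 ensures a <= b. *)
  set (eta := Rmin (1 / 2) (eps / (4 * (M + 1)))).
  assert (Heta : 0 < eta) by (apply Rmin_glb_lt; [lra | apply Rdiv_lt_0_compat; lra]).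
  assert (Heta1 : eta <= 1 / 2) by apply Rmin_l.
  assert (Heta2 : eta * (4 * (M + 1)) <= eps) by (apply Rle_div_r; [lra | apply Rmin_r]).
  destruct (HI (fun y => Rabs (y - I) < eps / 2)) as [P Q [dP HP] [dQ HQ] HPQ].
  { exists (mkposreal (eps / 2) ltac:(lra)); intros y Hy; exact Hy. }
  set (a := Rmin eta (dP / 2)); set (b := 1 - Rmin eta (dQ / 2)).
  pose proof (cond_pos dP) as HdP; pose proof (cond_pos dQ) as HdQ.
  assert (Ha : 0 < a <= eta /\ a < dP).
  { unfold a; split; [split; [apply Rmin_glb_lt; lra | apply Rmin_l]|].
    eapply Rle_lt_trans; [apply Rmin_r | lra]. }
  assert (Hb : 0 < 1 - b <= eta /\ 1 - b < dQ).
  { unfold b; replace (1 - (1 - Rmin eta (dQ / 2))) with (Rmin eta (dQ / 2)) by ring.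
    split; [split; [apply Rmin_glb_lt; lra | apply Rmin_l]|].
    eapply Rle_lt_trans; [apply Rmin_r | lra]. }
  destruct (HPQ a b) as [y [Hy1 Hy2]].
  { apply HP; [change (Rabs (a - 0) < dP); rewrite Rabs_pos_eq; lra | lra]. }
  { apply HQ; [change (Rabs (b - 1) < dQ); rewrite Rabs_left; lra | lra]. }
  simpl in Hy1.
  assert (Hsub : forall c d, 0 <= c -> c <= d -> d <= 1 -> is_RInt g c d (RInt g c d)).
  { intros c d H1 H2 H3; apply (RInt_correct (V := R_CompleteNormedModule)), ex_RInt_continuous.
    intros r; rewrite Rmin_left, Rmax_right by lra; intros Hr; apply Hc; lra. }
  assert (Hbd : forall c d, 0 <= c -> c <= d -> d <= 1 -> RInt g c d <= (d - c) * M).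
  { intros c d H1 H2 H3.
    apply (is_RInt_le g (fun _ => M) c d _ _ H2 (Hsub c d H1 H2 H3)).
    - apply (is_RInt_const (V := R_NormedModule)).
    - intros r Hr; apply HM; lra. }
  assert (HGE : G = RInt g 0 a + RInt g a b + RInt g b 1).
  { rewrite <- (is_RInt_unique _ _ _ _ HG).
    apply (is_RInt_unique g 0 1).
    exact (is_RInt_Chasles g 0 b 1 _ _
      (is_RInt_Chasles g 0 a b _ _ (Hsub 0 a ltac:(lra) ltac:(lra) ltac:(lra))
        (Hsub a b ltac:(lra) ltac:(lra) ltac:(lra)))
      (Hsub b 1 ltac:(lra) ltac:(lra) ltac:(lra))). }
  assert (Hmid : RInt g a b <= y).
  { apply (is_RInt_le g _ a b _ _ ltac:(lra) (Hsub a b ltac:(lra) ltac:(lra) ltac:(lra)) Hy1).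
    intros r Hr; unfold g; rewrite (HvV r) by lra.
    pose proof (Rpower_moment_lower r s n ltac:(lra) Hs).
    assert (0 < v r) by (rewrite <- HvV by lra; apply HV; lra).
    replace (s * (r ^ n * v r * (1 - r))) with (s * (r ^ n * (1 - r)) * v r) by ring.
    apply Rmult_le_compat_r; lra. }
  apply Rabs_def2 in Hy2.
  pose proof (Hbd 0 a ltac:(lra) ltac:(lra) ltac:(lra)).
  pose proof (Hbd b 1 ltac:(lra) ltac:(lra) ltac:(lra)).
  assert ((a - 0) * M <= eta * M) by (apply Rmult_le_compat_r; lra).
  assert ((1 - b) * M <= eta * M) by (apply Rmult_le_compat_r; lra).
  lra.
Qed.

(** * Toeplitz multipliers *)

Lemma weight_positive_profile (v : C -> R) : is_weight v -> positive_profile (profile01 v).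
Proof.
  intros [Hc [Hp [_ [H0 _]]]].
  assert (Hdisc : forall r, -1 < r < 1 -> disc (RtoC r)).
  { intros r Hr; unfold disc; rewrite Cmod_R; apply Rabs_def1; lra. }
  split.
  - intros r Hr; apply continuous_eps; intros eps Heps.
    destruct (Rlt_le_dec r 1) as [Hr1|Hr1].
    + assert (HP : locally (v (RtoC r)) (fun y => Rabs (y - v (RtoC r)) < eps))
        by (exists (mkposreal eps Heps); intros y Hy; exact Hy).
      destruct (Hc (RtoC r) (Hdisc r ltac:(lra)) _ HP) as [d Hd].
      pose proof (cond_pos d) as Hd0.
      exists (Rmin d (1 - r)); split; [apply Rmin_glb_lt; lra|].
      intros t Ht; apply Rmin_Rgt in Ht as [Ht1 Ht2].
      apply Rabs_def2 in Ht2.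
      unfold profile01; destruct (Rlt_dec r 1) as [_|]; [|lra].
      destruct (Rlt_dec t 1) as [_|]; [|lra].
      apply (Hd (RtoC t)); split; [exact Ht1|].
      change (Rabs (0 - 0) < d); rewrite Rminus_diag, Rabs_R0; exact Hd0.
    + destruct (H0 eps Heps) as [d [Hd K]].
      (* Here r = 1, and distance less than 1 keeps t positive, so that |t| = t. *)
      exists (Rmin d 1); split; [apply Rmin_glb_lt; lra|].
      intros t Ht; apply Rmin_Rgt in Ht as [Ht1 Ht2].
      apply Rabs_def2 in Ht1; apply Rabs_def2 in Ht2.
      unfold profile01; destruct (Rlt_dec r 1) as [|_]; [lra|].
      rewrite Rminus_0_r.
      destruct (Rlt_dec t 1) as [Ht3|_]; [|rewrite Rabs_R0; exact Heps].
      apply K; [apply Hdisc; lra|].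
      rewrite Cmod_R, Rabs_pos_eq; lra.
  - intros r Hr; unfold profile01; destruct (Rlt_dec r 1); [|lra].
    apply Hp, Hdisc; lra.
Qed.

(** Composition with [clamp] extends a profile known only on [0, 1] to a continuous function on R,
    as the lemmas on [mean] require. *)
Definition clamp (r : R) : R := Rmax 0 (Rmin 1 r).

Lemma clamp_bounds (r : R) : 0 <= clamp r <= 1.
Proof.
  unfold clamp; split; [apply Rmax_l|].
  apply Rmax_lub; [lra | apply Rmin_l].
Qed.

Lemma clamp_id (r : R) : 0 <= r <= 1 -> clamp r = r.
Proof. intros Hr; unfold clamp; rewrite Rmin_right, Rmax_right; lra. Qed.

Lemma clamp_contraction (r s : R) : Rabs (clamp s - clamp r) <= Rabs (s - r).
Proof.
  unfold clamp, Rmax, Rmin.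
  repeat destruct Rle_dec; unfold Rabs; repeat destruct Rcase_abs; lra.
Qed.

(** The mean value theorem is applied to the clamped function: it needs derivatives only strictly
    between the two points, where the one-sided notion is the usual one, and continuity at the ends.
    The constant is the maximum of |p'|. *)
Lemma C1_lipschitz (p p' : R -> R) :
  (forall x, 0 <= x <= 1 -> forall eps, 0 < eps -> exists d, 0 < d /\
     forall y, 0 <= y <= 1 -> Rabs (y - x) < d ->
       Rabs (p y - p x - (y - x) * p' x) <= eps * Rabs (y - x)) ->
  (forall x, 0 <= x <= 1 -> forall eps, 0 < eps -> exists d, 0 < d /\
     forall y, 0 <= y <= 1 -> Rabs (y - x) < d -> Rabs (p' y - p' x) < eps) ->
  exists L, 0 <= L /\ lipschitz01 L p.
Proof.
  intros Hd Hc'.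
  assert (C' : forall x, continuous (fun t => p' (clamp t)) x).
  { intros x; apply continuous_eps; intros eps Heps.
    destruct (Hc' _ (clamp_bounds x) eps Heps) as [d [Hd0 K]].
    exists d; split; auto; intros t Ht; apply K; [apply clamp_bounds|].
    eapply Rle_lt_trans; [apply clamp_contraction | exact Ht]. }
  assert (C0 : forall x, continuous (fun t => p (clamp t)) x).
  { intros x; apply continuous_eps; intros eps Heps.
    destruct (Hd _ (clamp_bounds x) 1 Rlt_0_1) as [d [Hd0 K]].
    set (q := Rabs (p' (clamp x))); assert (Hq : 0 <= q) by apply Rabs_pos.
    assert (He : 0 < eps / (2 + q)) by (apply Rdiv_lt_0_compat; lra).
    exists (Rmin d (eps / (2 + q))); split; [apply Rmin_glb_lt; lra|].
    intros t Ht; apply Rmin_Rgt in Ht as [Ht1 Ht2].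
    pose proof (clamp_contraction x t) as Hcl.
    specialize (K (clamp t) (clamp_bounds t) ltac:(lra)).
    set (D := clamp t - clamp x) in *.
    replace (p (clamp t) - p (clamp x))
      with ((p (clamp t) - p (clamp x) - D * p' (clamp x)) + D * p' (clamp x)) by ring.
    eapply Rle_lt_trans; [apply Rabs_triang|]; rewrite Rabs_mult; fold q.
    assert (H1 : Rabs D < eps / (2 + q)) by lra.
    apply Rlt_div_r in H1; [|lra].
    pose proof (Rabs_pos D); nra. }
  destruct (continuity_ab_maj (fun t => Rabs (p' (clamp t))) 0 1 Rle_0_1) as [x [Hx _]].
  { intros c _; apply continuity_pt_filterlim.
    apply (continuous_comp (fun t => p' (clamp t)) Rabs); [apply C' | apply continuous_Rabs]. }
  exists (Rabs (p' (clamp x))); split; [apply Rabs_pos|].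
  intros r s Hr Hs.
  destruct (MVT_gen (fun t => p (clamp t)) r s (fun t => p' (clamp t))) as [c [Hcc E]].
  - intros t Ht.
    assert (Ht01 : 0 < t < 1).
    { split; [apply Rle_lt_trans with (Rmin r s) | apply Rlt_le_trans with (Rmax r s)];
        try lra; [apply Rmin_glb | apply Rmax_lub]; lra. }
    split; [apply is_linear_scal_l|].
    intros t' Ht'; apply (is_filter_lim_locally_unique (V := R_NormedModule)) in Ht'.
    subst t'; intros eps.
    destruct (Hd t ltac:(lra) eps (cond_pos eps)) as [d [Hd0 K]].
    (* The inner minimum keeps y in (0, 1), where [clamp] is the identity. *)
    exists (mkposreal (Rmin d (Rmin t (1 - t))) ltac:(repeat apply Rmin_glb_lt; lra)).
    intros y Hy; change (Rabs (y - t) < Rmin d (Rmin t (1 - t))) in Hy.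
    apply Rmin_Rgt in Hy as [Hy1 Hy2]; apply Rmin_Rgt in Hy2 as [Hy2 Hy3].
    apply Rabs_def2 in Hy2; apply Rabs_def2 in Hy3.
    rewrite (clamp_id y), (clamp_id t) by lra.
    apply K; lra.
  - intros t _; apply continuity_pt_filterlim, C0.
  - rewrite (clamp_id r), (clamp_id s) in E by lra.
    rewrite E, Rabs_mult; apply Rmult_le_compat_r; [apply Rabs_pos|].
    apply Hx; split.
    + eapply Rle_trans; [|apply Hcc]; apply Rmin_glb; lra.
    + eapply Rle_trans; [apply Hcc|]; apply Rmax_lub; lra.
Qed.

Lemma lipschitz_clamp (L : R) (p : R -> R) :
  0 <= L -> lipschitz01 L p ->
  (forall r, continuous (fun t => p (clamp t)) r) /\ lipschitz01 L (fun t => p (clamp t)).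
Proof.
  intros HL0 HL; split.
  - intros r; apply continuous_eps; intros eps Heps.
    exists (eps / (L + 1)); split; [apply Rdiv_lt_0_compat; lra|].
    intros t Ht; apply Rlt_div_r in Ht; [|lra].
    eapply Rle_lt_trans; [apply HL; apply clamp_bounds|].
    pose proof (clamp_contraction r t); pose proof (Rabs_pos (t - r)); nra.
  - intros r s Hr Hs; rewrite (clamp_id r), (clamp_id s) by lra; apply HL; auto.
Qed.

Lemma C1_symbol_lipschitz (f : R -> C) :
  C1_on_unit_interval f ->
  exists L, 0 <= L /\ lipschitz01 L (fun r => fst (f r)) /\ lipschitz01 L (fun r => snd (f r)).
Proof.
  intros [f' [Hd Hc]].
  assert (Hd' : forall x, 0 <= x <= 1 -> forall eps, 0 < eps -> exists d, 0 < d /\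
     forall y, 0 <= y <= 1 -> Rabs (y - x) < d ->
       Cmod (f y - f x - RtoC (y - x) * f' x) <= eps * Rabs (y - x)).
  { intros x Hx eps Heps; destruct (Hd x Hx) as [_ H].
    assert (Hl : is_filter_lim (within unit_interval (locally x)) x).
    { intros P [d HP]; exists d; intros y Hy _; apply HP, Hy. }
    destruct (H x Hl (mkposreal eps Heps)) as [d K].
    exists d; split; [apply cond_pos|]; intros y Hy Hyx.
    specialize (K y Hyx Hy); simpl in K.
    rewrite Cmod_norm.
    replace (f y - f x - RtoC (y - x) * f' x)%C
      with (minus (minus (f y) (f x)) (@scal R_AbsRing C_R_NormedModule (minus y x) (f' x)));
      [exact K|].
    apply injective_projections.
    - change (fst (f y) + - fst (f x) + - ((y + - x) * fst (f' x))
        = fst (f y) + - fst (f x) + - ((y - x) * fst (f' x) - 0 * snd (f' x))); ring.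
    - change (snd (f y) + - snd (f x) + - ((y + - x) * snd (f' x))
        = snd (f y) + - snd (f x) + - ((y - x) * snd (f' x) + 0 * fst (f' x))); ring. }
  assert (Hc' : forall x, 0 <= x <= 1 -> forall eps, 0 < eps -> exists d, 0 < d /\
     forall y, 0 <= y <= 1 -> Rabs (y - x) < d ->
       Rabs (fst (f' y) - fst (f' x)) < eps /\ Rabs (snd (f' y) - snd (f' x)) < eps).
  { intros x Hx eps Heps.
    destruct (Hc x Hx (ball (f' x) eps)) as [d K].
    { exists (mkposreal eps Heps); intros y Hy; exact Hy. }
    exists d; split; [apply cond_pos|]; intros y Hy Hyx.
    exact (K y Hyx Hy). }
  destruct (C1_lipschitz (fun r => fst (f r)) (fun r => fst (f' r))) as [L1 [P1 H1]].
  { intros x Hx eps Heps; destruct (Hd' x Hx eps Heps) as [d [Hd0 K]].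
    exists d; split; auto; intros y Hy Hyx.
    eapply Rle_trans; [|apply (K y Hy Hyx)].
    eapply Rle_trans; [|apply abs_fst_le]; apply Req_le; f_equal; simpl; ring. }
  { intros x Hx eps Heps; destruct (Hc' x Hx eps Heps) as [d [Hd0 K]].
    exists d; split; auto; intros y Hy Hyx; apply (K y Hy Hyx). }
  destruct (C1_lipschitz (fun r => snd (f r)) (fun r => snd (f' r))) as [L2 [P2 H2]].
  { intros x Hx eps Heps; destruct (Hd' x Hx eps Heps) as [d [Hd0 K]].
    exists d; split; auto; intros y Hy Hyx.
    eapply Rle_trans; [|apply (K y Hy Hyx)].
    eapply Rle_trans; [|apply abs_snd_le]; apply Req_le; f_equal; simpl; ring. }
  { intros x Hx eps Heps; destruct (Hc' x Hx eps Heps) as [d [Hd0 K]].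
    exists d; split; auto; intros y Hy Hyx; apply (K y Hy Hyx). }
  exists (L1 + L2); split; [lra|]; split; intros r s Hr Hs.
  - eapply Rle_trans; [apply H1; auto|]; pose proof (Rabs_pos (s - r)); nra.
  - eapply Rle_trans; [apply H2; auto|]; pose proof (Rabs_pos (s - r)); nra.
Qed.

(** The integrals see only the open interval, on which [clamp] and the extension of v by 0 change
    nothing. *)
Lemma toeplitz_coeff_mean (v : C -> R) (a : C -> C) (f : R -> C) (n : nat) :
  positive_profile (profile01 v) ->
  (forall r, 0 <= r < 1 -> a (RtoC r) = f r) ->
  (forall r, continuous (fun t => fst (f (clamp t))) r) ->
  (forall r, continuous (fun t => snd (f (clamp t))) r) ->
  toeplitz_coeff v a n =
    (mean (profile01 v) (fun t => fst (f (clamp t))) n,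
     mean (profile01 v) (fun t => snd (f (clamp t))) n).
Proof.
  intros HV Haf H1 H2; set (V := profile01 v) in *.
  assert (HvV : forall r, 0 < r < 1 -> v (RtoC r) = V r).
  { intros r Hr; unfold V, profile01; destruct (Rlt_dec r 1); [reflexivity | lra]. }
  assert (Hden : RInt (fun r => r ^ (2 * n + 1) * v (RtoC r)) 0 1 = RInt (mweight V n) 0 1).
  { apply RInt_ext; intros r; rewrite Rmin_left, Rmax_right by lra; intros Hr.
    unfold mweight; rewrite HvV by lra; reflexivity. }
  assert (I : forall p, (forall r, continuous p r) ->
     is_RInt (fun r => mweight V n r * p r) 0 1 (RInt (fun r => mweight V n r * p r) 0 1)).
  { intros p Hp; apply is_RInt_01; intros r Hr; apply continuous_Rmult;
      [apply mweight_cont; auto | apply Hp]. }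
  assert (Hnum : @RInt C_R_CompleteNormedModule
       (fun r => Cmult (RtoC (r ^ (2 * n + 1) * v (RtoC r))) (a (RtoC r))) 0 1
     = (RInt (fun r => mweight V n r * fst (f (clamp r))) 0 1,
        RInt (fun r => mweight V n r * snd (f (clamp r))) 0 1)).
  { apply is_RInt_unique.
    apply (is_RInt_ext (V := C_R_NormedModule)
      (fun r => (mweight V n r * fst (f (clamp r)), mweight V n r * snd (f (clamp r))))).
    - intros r; rewrite Rmin_left, Rmax_right by lra; intros Hr.
      rewrite clamp_id, Haf, HvV by lra; unfold mweight.
      destruct (f r) as [x y]; unfold Cmult; simpl; f_equal; ring.
    - apply (is_RInt_fct_extend_pair (U := R_NormedModule) (V := R_NormedModule)); simpl;
        [apply (I _ H1) | apply (I _ H2)]. }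
  unfold toeplitz_coeff; rewrite Hnum, Hden; unfold mean.
  pose proof (mweight_mass_pos V n HV) as HD.
  unfold Cdiv, Cinv, Cmult; simpl; f_equal; field; lra.
Qed.

(** The moment condition at the exponent 2n + 1, with s = (2n + 1)^eps in [improper_moment_lower].
    The constant is made nonnegative because its square root is taken later. *)
Lemma moment_one_minus_rho (v : C -> R) (eps : R) :
  positive_profile (profile01 v) -> moment_condition v eps ->
  exists M, 0 <= M /\ forall n,
    (1 - rho (profile01 v) n) * Rpower (INR (2 * n + 1)) eps <= M.
Proof.
  intros HV [M HM]; exists (Rmax 0 M); split; [apply Rmax_l|]; intros n.
  eapply Rle_trans; [|apply Rmax_r].
  set (V := profile01 v) in *.
  assert (HvV : forall r, 0 < r < 1 -> V r = v (RtoC r)).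
  { intros r Hr; unfold V, profile01; destruct (Rlt_dec r 1); [reflexivity | lra]. }
  destruct (HM (2 * n + 1)%nat ltac:(lia)) as [I [HI HIM]].
  set (s := Rpower (INR (2 * n + 1)) eps) in *.
  assert (Hs : 0 < s) by (apply exp_pos).
  pose proof (improper_moment_lower (fun r => v (RtoC r)) V _ s I HV HvV (Rlt_le _ _ Hs) HI) as H.
  assert (Hden : RInt (fun r => r ^ (2 * n + 1) * v (RtoC r)) 0 1 = RInt (mweight V n) 0 1).
  { apply RInt_ext; intros r; rewrite Rmin_left, Rmax_right by lra; intros Hr.
    unfold mweight; rewrite HvV by lra; reflexivity. }
  rewrite Hden in HIM.
  eapply Rle_trans; [|exact HIM].
  rewrite one_minus_rho by auto.
  pose proof (mweight_mass_pos V n HV) as HD.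
  unfold Rdiv; rewrite (Rmult_comm _ s), <- Rmult_assoc.
  apply Rmult_le_compat_r; [apply Rlt_le, Rinv_0_lt_compat, HD | exact H].
Qed.

(** The upper bound for the Lebesgue constant that [partial_sum_bound] provides, not the constant
    itself. *)
Definition lebesgue (n : nat) : R := 4 + 2 * ln (INR (S n)).

Lemma ln_INR_nonneg (n : nat) : 0 <= ln (INR (S n)).
Proof.
  rewrite <- ln_1; apply ln_le; [lra | apply (le_INR 1); lia].
Qed.

(** With e^t = (n + 1)^(eps / 2) the logarithm is (2 / eps) t, and both 1 and t are at most e^t;
    this gives the factor 4 + 4 / eps. The decay of [d] says exactly that e^t times the square root
    of [d n] stays bounded. *)
Lemma lebesgue_sqrt_bound (d : nat -> R) (eps M : R) :
  0 < eps -> 0 <= M ->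
  (forall n, d n * Rpower (INR (2 * n + 1)) eps <= M) -> (forall n, 0 <= d n) ->
  forall n, lebesgue n * sqrt (d n) <= (4 + 4 / eps) * sqrt M.
Proof.
  intros He HM Hd Hd0 n.
  pose proof (ln_INR_nonneg n) as Hl.
  set (t := ln (INR (S n)) * (eps / 2)).
  assert (Ht : 0 <= t) by (apply Rmult_le_pos; lra).
  assert (Hleb : lebesgue n <= (4 + 4 / eps) * exp t).
  { unfold lebesgue; replace (ln (INR (S n))) with (2 / eps * t) by (unfold t; field; lra).
    pose proof (exp_ineq1_le t).
    assert (0 < / eps) by (apply Rinv_0_lt_compat; lra).
    unfold Rdiv; nra. }
  assert (Hdt : d n * (exp t * exp t) <= M).
  { eapply Rle_trans; [|apply (Hd n)].
    apply Rmult_le_compat_l; [auto|].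
    rewrite <- exp_plus; unfold Rpower.
    assert (Hexp : t + t <= eps * ln (INR (2 * n + 1))).
    { replace (t + t) with (eps * ln (INR (S n))) by (unfold t; field).
      apply Rmult_le_compat_l; [lra|].
      apply ln_le; [apply lt_0_INR; lia | apply le_INR; lia]. }
    destruct (Rle_lt_or_eq_dec _ _ Hexp) as [K|K];
      [left; apply exp_increasing, K | rewrite K; apply Rle_refl]. }
  assert (Hsq : sqrt (d n) * exp t <= sqrt M).
  { rewrite <- (sqrt_square (exp t)) by (apply Rlt_le, exp_pos).
    rewrite <- sqrt_mult_alt by auto.
    apply sqrt_le_1_alt, Hdt. }
  pose proof (sqrt_pos (d n)).
  assert (0 < 4 + 4 / eps)
    by (pose proof (Rdiv_lt_0_compat 4 eps ltac:(lra) He); lra).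
  apply Rle_trans with ((4 + 4 / eps) * exp t * sqrt (d n)).
  - apply Rmult_le_compat_r; auto.
  - rewrite Rmult_assoc, (Rmult_comm (exp t)); apply Rmult_le_compat_l; lra.
Qed.

(* [(d_k - d_(k+1)) l_k = (sqrt d_k - sqrt d_(k+1)) (sqrt d_k + sqrt d_(k+1)) l_k], and the
   last two factors contribute at most [2 B]. *)
Lemma weighted_variation_bound (d l : nat -> R) (B : R) (n : nat) :
  (forall k, 0 <= d (S k) <= d k) -> (forall k, 0 <= l k) ->
  (forall k, l k * sqrt (d k) <= B) ->
  sum_f_R0 (fun k => (d k - d (S k)) * l k) n <= 2 * B * sqrt (d 0%nat).
Proof.
  intros Hd Hl HB.
  assert (HB0 : 0 <= B).
  { eapply Rle_trans; [|apply (HB 0%nat)]; apply Rmult_le_pos; [auto | apply sqrt_pos]. }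
  apply Rle_trans with (2 * B * (sqrt (d 0%nat) - sqrt (d (S n)))).
  2: { pose proof (sqrt_pos (d (S n))); apply Rmult_le_compat_l; lra. }
  assert (Hstep : forall k, (d k - d (S k)) * l k <= 2 * B * (sqrt (d k) - sqrt (d (S k)))).
  { intros k; specialize (Hd k); specialize (HB k); specialize (Hl k).
    rewrite <- (sqrt_sqrt (d k)) at 1 by lra.
    rewrite <- (sqrt_sqrt (d (S k))) at 1 by lra.
    assert (Hs : sqrt (d (S k)) <= sqrt (d k)) by (apply sqrt_le_1_alt; lra).
    pose proof (sqrt_pos (d (S k))).
    set (x := sqrt (d k)) in *; set (y := sqrt (d (S k))) in *.
    replace ((x * x - y * y) * l k) with ((x - y) * (l k * x + l k * y)) by ring.
    rewrite (Rmult_comm (2 * B)); apply Rmult_le_compat_l; [lra|].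
    assert (l k * y <= l k * x) by (apply Rmult_le_compat_l; lra); lra. }
  induction n as [|n IH].
  - apply Hstep.
  - rewrite tech5; specialize (Hstep (S n)); lra.
Qed.

(** * Abel summation of the multiplier series *)

Lemma csum_abel (g a : nat -> C) (n : nat) :
  csum (fun k => g k * a k)%C (S n)
  = (g (S n) * csum a (S n) - csum (fun k => (g (S k) - g k) * csum a k) n)%C.
Proof.
  induction n as [|n IH].
  - rewrite !csum_S, !csum_0; ring.
  - rewrite (csum_S (fun k => g k * a k)%C (S n)), IH,
      (csum_S (fun k => (g (S k) - g k) * csum a k)%C n), (csum_S a (S n)); ring.
Qed.

(** The boundary term keeps the modulus of the partial sum itself: its bound [l (S n) * m] may grow
    with n, whereas the partial sum will converge to h(z). *)
Lemma multiplier_bound (g a : nat -> C) (d l : nat -> R) (L G B m : R) (n : nat) :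
  (forall k, 0 <= d (S k) <= d k) -> (forall k, 0 <= l k) ->
  (forall k, l k * sqrt (d k) <= B) -> 0 <= L -> 0 <= m ->
  (forall k, Cmod (g k) <= G) ->
  (forall k, Cmod (g (S k) - g k) <= L * (d k - d (S k))) ->
  (forall k, Cmod (csum a k) <= l k * m) ->
  Cmod (csum (fun k => g k * a k)%C (S n))
    <= G * Cmod (csum a (S n)) + L * (2 * B * sqrt (d 0%nat)) * m.
Proof.
  intros Hd Hl HB HL Hm HG Hg Ha.
  rewrite csum_abel; eapply Rle_trans; [apply Cmod_triangle|].
  rewrite Cmod_opp, Cmod_mult; apply Rplus_le_compat.
  - apply Rmult_le_compat_r; [apply Cmod_ge_0 | apply HG].
  - eapply Rle_trans; [apply csum_Cmod_le|].
    apply Rle_trans with (sum_f_R0 (fun k => (d k - d (S k)) * l k * (L * m)) n).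
    + apply sum_Rle; intros k _; rewrite Cmod_mult.
      replace ((d k - d (S k)) * l k * (L * m)) with (L * (d k - d (S k)) * (l k * m)) by ring.
      apply Rmult_le_compat; auto; apply Cmod_ge_0.
    + rewrite <- scal_sum.
      replace (L * (2 * B * sqrt (d 0%nat)) * m) with (L * m * (2 * B * sqrt (d 0%nat))) by ring.
      apply Rmult_le_compat_l; [apply Rmult_le_pos; auto|].
      apply weighted_variation_bound; auto.
Qed.

Lemma conv_unique_bound (a : nat -> C) (l : C) (X : R) :
  conv a l -> (forall eps, 0 < eps -> exists N, forall n, (N <= n)%nat -> Cmod (csum a n) <= X + eps) ->
  Cmod l <= X.
Proof.
  intros Ha HX; apply le_epsilon; intros eps Heps.
  destruct (HX eps Heps) as [N HN].
  replace l with (l - RtoC 0)%C by ring.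
  apply (conv_limit_bound a l 0 _ N Ha); intros n Hn.
  replace (csum a n - RtoC 0)%C with (csum a n) by ring; auto.
Qed.

(** * The weighted supremum norm and the theorem *)

Lemma norm_v_upper (v : C -> R) (h : C -> C) (z : C) :
  Rbar_lt (norm_v v h) p_infty -> disc z ->
  is_finite (norm_v v h) /\ Cmod (h z) * v (RtoC (Cmod z)) <= real (norm_v v h).
Proof.
  intros Hf Hz; unfold norm_v in *.
  set (S := fun x => exists z, disc z /\ x = Cmod (h z) * v (RtoC (Cmod z))) in *.
  destruct (Lub_Rbar_correct S) as [Hub _].
  specialize (Hub _ (ex_intro _ z (conj Hz eq_refl))).
  destruct (Lub_Rbar S); simpl in *; [split; [reflexivity | exact Hub] | contradiction | contradiction].
Qed.

Lemma norm_v_le (v : C -> R) (g : C -> C) (X : R) :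
  (forall z, disc z -> Cmod (g z) * v (RtoC (Cmod z)) <= X) ->
  Rbar_lt (norm_v v g) p_infty /\ real (norm_v v g) <= X.
Proof.
  intros HX; unfold norm_v.
  set (S := fun x => exists z, disc z /\ x = Cmod (g z) * v (RtoC (Cmod z))) in *.
  assert (H0 : disc 0) by (unfold disc; rewrite Cmod_0; lra).
  (* The value at 0 excludes a supremum of -oo, for which [real] would return the default 0. *)
  destruct (Lub_Rbar_correct S) as [Hub Hlub].
  specialize (Hub _ (ex_intro _ (RtoC 0) (conj H0 eq_refl))).
  specialize (Hlub (Finite X)).
  assert (Hle : Rbar_le (Lub_Rbar S) (Finite X))
    by (apply Hlub; intros x [z [Hz ->]]; apply HX, Hz).
  destruct (Lub_Rbar S); simpl in *; [auto | contradiction | contradiction].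
Qed.

Lemma toeplitz_increment (v : C -> R) (a : C -> C) :
  positive_profile (profile01 v) -> C1_symbol a ->
  exists L, 0 <= L /\ forall n,
    Cmod (toeplitz_coeff v a (S n) - toeplitz_coeff v a n)
      <= L * (rho (profile01 v) (S n) - rho (profile01 v) n).
Proof.
  intros HV [f [Hf Haf]].
  destruct (C1_symbol_lipschitz f Hf) as [L [HL0 [L1 L2]]].
  destruct (lipschitz_clamp L _ HL0 L1) as [C1 K1].
  destruct (lipschitz_clamp L _ HL0 L2) as [C2 K2].
  exists (2 * L); split; [lra|]; intros n.
  rewrite !(toeplitz_coeff_mean v a f _ HV Haf C1 C2).
  replace (2 * L * (rho (profile01 v) (S n) - rho (profile01 v) n))
    with (L * (rho (profile01 v) (S n) - rho (profile01 v) n)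
          + L * (rho (profile01 v) (S n) - rho (profile01 v) n)) by ring.
  eapply Rle_trans; [apply Cmod_le_abs|].
  exact (Rplus_le_compat _ _ _ _ (mean_increment (profile01 v) _ L n HV C1 K1)
    (mean_increment (profile01 v) _ L n HV C2 K2)).
Qed.

Theorem corollary1p5 :
  forall v : C -> R,
    is_weight v ->
    condition_B v ->
    (exists eps : R, 0 < eps /\ moment_condition v eps) ->
    forall a : C -> C,
      radial a ->
      C1_symbol a ->
      toeplitz_bounded v a.
Proof.
  intros v Hv _ [eps [Heps Hmom]] a _ Ha.
  pose proof (weight_positive_profile v Hv) as HV.
  set (V := profile01 v) in *.
  destruct (toeplitz_increment v a HV Ha) as [L [HL Hinc]].
  fold V in Hinc.
  destruct (moment_one_minus_rho v eps HV Hmom) as [M [HM HrhoM]].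
  fold V in HrhoM.
  set (d := fun n => 1 - rho V n).
  assert (Hd0 : forall n, 0 <= d n) by (intros n; apply one_minus_rho_nonneg, HV).
  assert (Hd : forall n, 0 <= d (S n) <= d n).
  { intros n; split; [auto|]; unfold d; pose proof (rho_nondecreasing V n HV); lra. }
  assert (Hleb0 : forall n, 0 <= lebesgue n)
    by (intros n; unfold lebesgue; pose proof (ln_INR_nonneg n); lra).
  pose proof (lebesgue_sqrt_bound d eps M Heps HM HrhoM Hd0) as HB.
  set (B := (4 + 4 / eps) * sqrt M) in *.
  set (gam := toeplitz_coeff v a) in *.
  assert (Hgam : forall n, Cmod (gam (S n) - gam n) <= L * (d n - d (S n))).
  { intros n; unfold d; eapply Rle_trans; [apply Hinc|]; apply Req_le; ring. }
  (* The increments of [gam] telescope to at most L (d_0 - d_n). *)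
  set (G := Cmod (gam 0%nat) + L * d 0%nat).
  assert (HG : forall n, Cmod (gam n) <= G).
  { assert (H : forall n, Cmod (gam n) <= Cmod (gam 0%nat) + L * (d 0%nat - d n)).
    { induction n as [|n IH]; [rewrite Rminus_diag, Rmult_0_r; lra|].
      replace (gam (S n)) with ((gam (S n) - gam n) + gam n)%C by ring.
      eapply Rle_trans; [apply Cmod_triangle|]; specialize (Hgam n); lra. }
    intros n; eapply Rle_trans; [apply H|]; unfold G.
    pose proof (Rmult_le_pos L (d n) HL (Hd0 n)); lra. }
  assert (HG0 : 0 <= G) by (eapply Rle_trans; [apply Cmod_ge_0 | apply (HG 0%nat)]).
  set (X := L * (2 * B * sqrt (d 0%nat))).
  exists (G + X); intros h [Hh Hnorm].
  destruct (taylor_disc h) as [c Hc].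
  { intros z Hz; destruct (Hh z Hz) as [D HD]; exists D; apply is_derive_cderiv, HD. }
  assert (Hc' : forall z, Cmod z < 1 -> conv (fun k => z ^ k * c k)%C (h z))
    by (intros z Hz; apply is_pseries_conv, Hc, Hz).
  pose proof (subexponential_of_conv c h Hc') as Hsub.
  set (c' := fun n => (gam n * c n)%C).
  assert (Hsub' : subexponential c').
  { intros s Hs; destruct (Hsub s Hs) as [Bs HBs]; exists (G * Bs); intros n.
    unfold c'; rewrite Cmod_mult, Rmult_assoc.
    apply Rmult_le_compat; auto; [apply Cmod_ge_0|].
    apply Rmult_le_pos; [apply Cmod_ge_0 | apply pow_le; lra]. }
  (* The condition on z stands inside the existential so that choice yields a total function;
     outside the disc any value serves. *)
  assert (Hex : forall z, exists l, Cmod z < 1 -> conv (fun k => z ^ k * c' k)%C l).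
  { intros z; destruct (Rlt_le_dec (Cmod z) 1) as [Hz|Hz]; [|exists 0; intros; lra].
    destruct (subexponential_conv c' (Cmod z) Hsub') as [B' [x [Hx HB']]];
      [split; [apply Cmod_ge_0 | auto]|].
    destruct (geometric_conv (fun k => z ^ k * c' k)%C B' x Hx) as [l [Hl _]];
      [intros i; apply HB'; lra|].
    exists l; auto. }
  set (g := fun z => proj1_sig (constructive_indefinite_description _ (Hex z))).
  assert (Hg : forall z, Cmod z < 1 -> conv (fun k => z ^ k * c' k)%C (g z)).
  { intros z; unfold g; destruct constructive_indefinite_description as [l Hl]; exact Hl. }
  assert (Hbound : forall z, disc z ->
     Cmod (g z) * v (RtoC (Cmod z)) <= (G + X) * real (norm_v v h)).
  { intros z Hz; unfold disc in Hz.
    set (H := real (norm_v v h)).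
    assert (Hvz : 0 < v (RtoC (Cmod z))).
    { apply Hv; unfold disc; rewrite Cmod_R, Rabs_pos_eq; [auto | apply Cmod_ge_0]. }
    (* The norm bounds |h| by [m] on the whole circle through z, because the weight in [norm_v]
       depends on |w| only. *)
    set (m := H / v (RtoC (Cmod z))).
    assert (Hm : forall w, Cmod w = Cmod z -> Cmod (h w) <= m).
    { intros w Hw; apply (proj1 (Rle_div_r _ _ _ Hvz)).
      rewrite <- Hw; apply norm_v_upper; [auto | unfold disc; lra]. }
    assert (Hm0 : 0 <= m) by (eapply Rle_trans; [apply Cmod_ge_0 | apply (Hm z eq_refl)]).
    assert (Hgz : Cmod (g z) <= (G + X) * m).
    { apply (conv_unique_bound _ _ _ (Hg z Hz)); intros e0 He0.
      (* This error is multiplied by [G] in the boundary term and must remain below e0. *)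
      destruct (Hc' z Hz (e0 / (G + 1))) as [N HN]; [apply Rdiv_lt_0_compat; lra|].
      exists (S N); intros n Hn; destruct n as [|n]; [lia|].
      specialize (HN (S n) ltac:(lia)).
      rewrite (csum_ext _ (fun k => gam k * (z ^ k * c k))%C)
        by (intros k _; unfold c'; ring).
      eapply Rle_trans;
        [apply (multiplier_bound gam _ d lebesgue L G B m); auto|].
      - intros k; apply (partial_sum_bound c h); auto.
      - fold X.
        pose proof (Cmod_minus_triangle (csum (fun k => z ^ k * c k)%C (S n)) (h z)) as Ht.
        specialize (Hm z eq_refl).
        assert (Hs : Cmod (csum (fun k => z ^ k * c k)%C (S n)) <= m + e0 / (G + 1)) by lra.
        assert (G * (e0 / (G + 1)) <= e0).
        { replace (G * (e0 / (G + 1))) with (e0 * (G / (G + 1))) by (field; lra).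
          assert (G / (G + 1) <= 1) by (apply Rle_div_l; lra); nra. }
        assert (G * Cmod (csum (fun k => z ^ k * c k)%C (S n)) <= G * (m + e0 / (G + 1)))
          by (apply Rmult_le_compat_l; auto).
        lra. }
    replace ((G + X) * H) with ((G + X) * m * v (RtoC (Cmod z))) by (unfold m; field; lra).
    apply Rmult_le_compat_r; [lra | exact Hgz]. }
  destruct (norm_v_le v g _ Hbound) as [Hfin Hle].
  exists g; split; [|split; [split; [|exact Hfin] | exact Hle]].
  - exists c; intros z Hz; split; [apply Hc, Hz | apply is_pseries_conv, (Hg z Hz)].
  - intros z Hz; destruct (pseries_cdiff c' g Hsub' Hg z Hz) as [D HD].
    exists D; apply is_derive_cderiv, HD.
Qed.
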